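(* Let $\Omega\in(0,\pi)$, let $N$ be an even integer with $N>\frac{\Omega}{\pi-\Omega}$, and let $\Omega_1\in(\Omega,\pi)$ be such that $N\ge\frac{\Omega_1}{\pi-\Omega_1}$. Let $g:\mathbb{R}\to[\Omega_1,\pi]$ be the $1$-periodic function with $g(t)=\frac{\pi N}{t}$ for $t\in[N,N+1)$. Then for every continuous bounded band-limited signal $x\in C(\mathbb{R})\cap\mathcal{V}(\Omega)$, every integer $m$ and every $t\in[N+m,N+m+1)$, $$x(t)=\sum_{k\in\mathbb{Z}}a_k(t)\,x(k),$$ where $a_m(t)=1-\frac{g(t)}{\pi}$ and $$a_k(t)=\frac{(t-m)\sin[g(t)(k-m)]}{\pi(k-m)(k-t)},\qquad k\in\mathbb{Z},\ k\ne m,$$ (with $a_k(t)=1$ when $t=k$, in which case the displayed expression is of the form $0/0$). The series is absolutely convergent.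
   Context: Functions are complex valued. $C(\mathbb{R})$ is the space of continuous functions $\mathbb{R}\to\mathbb{C}$ with the norm $\sup_t|f(t)|$. For $y\in L_1(\mathbb{R})$, its Fourier transform is $Y(\omega)=\int_{-\infty}^\infty e^{-i\omega t}y(t)\,dt$. Spectral gap: for a Borel set $D\subset\mathbb{R}$ with non-empty interior, $D$ is a spectral gap of $x\in L_\infty(\mathbb{R})$ if $\int_{-\infty}^\infty x(t)y(t)\,dt=0$ for every $y\in L_1(\mathbb{R})$ whose Fourier transform $Y$ vanishes identically on $\mathbb{R}\setminus D$. For $\Omega>0$, $\mathcal{V}(\Omega)$ is the set of all $x\in L_\infty(\mathbb{R})$ having spectral gap $\mathbb{R}\setminus(-\Omega,\Omega)$; these signals are called band-limited. *)

(* Defs.v *)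
From HB Require Import structures.
From mathcomp Require Import all_boot all_order all_algebra finmap.
From mathcomp Require Import complex.
From mathcomp Require Import all_classical all_reals all_analysis.
From mathcomp Require summability.

Set Implicit Arguments.
Unset Strict Implicit.
Unset Printing Implicit Defensive.

Import Order.TTheory GRing.Theory Num.Theory.
Import numFieldNormedType.Exports.

Local Open Scope classical_set_scope.
Local Open Scope ring_scope.
Local Open Scope complex_scope.

Section ComplexSignals.
Variable R : realType.
Implicit Types (x y : R -> R[i]) (D : set R).

(* The norm `|z| of z : R[i] is itself an element of R[i], namely a nonnegative
   real number; cabs z is the same number seen in R. *)
Definition cabs (z : R[i]) : R := complex.Re `|z|.

(* e^(i u) *)
Definition expi (u : R) : R[i] := cos u +i* sin u.

(* Members of L_1(R) and L_oo(R) are handled through Borel measurable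
   representatives; a complex function is in L_p iff both its real and its
   imaginary parts are. *)
Definition in_Lp (p : \bar R) (f : R -> R[i]) : Prop :=
  (fun t => complex.Re (f t)) \in Lfun (@lebesgue_measure R) p /\
  (fun t => complex.Im (f t)) \in Lfun (@lebesgue_measure R) p.

Definition cintegral (f : R -> R[i]) : R[i] :=
  (\int[@lebesgue_measure R]_t complex.Re (f t)) +i*
  (\int[@lebesgue_measure R]_t complex.Im (f t)).

Definition fourier y (omega : R) : R[i] :=
  cintegral (fun t => expi (- (omega * t)) * y t).

(* measurable refers here to the Borel sigma-algebra of R. *)
Definition spectral_gap D x : Prop :=
  [/\ measurable D, interior D !=set0 &
      forall y, in_Lp 1%E y ->
        (forall omega, ~ D omega -> fourier y omega = 0) ->
        cintegral (fun t => x t * y t) = 0].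

Definition band_limited (Omega : R) : set (R -> R[i]) :=
  [set x | in_Lp +oo%E x /\
           spectral_gap (~` [set omega | - Omega < omega < Omega]) x].

(* R[i]^o is R[i] with the topology of its norm. *)
Definition continuous_bounded : set (R -> R[i]) :=
  [set x | continuous (x : R -> R[i]^o) /\
           exists M : R, forall t, cabs (x t) <= M].

Definition absolutely_convergent (I : choiceType) (f : I -> R[i]) : Prop :=
  summable [set: I] (fun k => (cabs (f k))%:E).

(* f has the unordered sum s: the sums over finite subsets of I converge to s
   along the filter of finite subsets ordered by inclusion. *)
Definition has_sum (I : choiceType) (f : I -> R[i]) (s : R[i]) : Prop :=
  (summability.partial_sum f : {fset I} -> R[i]^o) @ summability.totally
    --> (s : R[i]^o).

(* The coefficients a_k(t), for k : int, of the expansion based at m. *)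
Definition coef (g : R -> R) (m k : int) (t : R) : R :=
  if k == m then 1 - g t / pi
  else if t == k%:~R then 1
  else (t - m%:~R) * sin (g t * (k - m)%:~R)
         / (pi * (k - m)%:~R * (k%:~R - t)).

End ComplexSignals.

(* Main.v *)
(* Translate so that m = 0, and put s = t in [N, N + 1) and G = g(t), so that
   G s = pi N. Since N is even, e^(i w s) = 1 at w = +-G, and the function
   equal to e^(i w s) for |w| <= G and to 1 for G <= |w| <= pi is continuous;
   the a_k are its Fourier coefficients, so they are O(1/k^2) and
   e^(i w s) = sum_k a_k e^(i w k) for |w| < G, in particular on the band.
   Now let y be the indicator of [s, s + e] minus the sum of the a_k times the
   indicators of [k, k + e]. Its Fourier transform vanishes on the band, hence
   int x y = 0: the average of x over [s, s + e] is the sum of the a_k times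
   its averages over [k, k + e]. Letting e tend to 0 gives the expansion.

   The pointwise Fourier expansion is obtained by hand. The two series
   sum 2s/(j^2-s^2) cos(jx) and sum 2s^2/(j(j^2-s^2)) sin(jx) satisfy, partial
   sum by partial sum, a rotation equation forced by sum sin(jx)/j, whose
   convergence to (pi-x)/2 is uniform on compact subsets of (0, 2pi). This
   determines both limits on (0, 2pi) up to one constant, which is found at
   x = 0. *)
Require Import Defs.
From mathcomp Require Import all_boot all_order all_algebra finmap.
From mathcomp Require Import complex.
From mathcomp Require Import all_classical all_reals all_analysis.
From mathcomp Require Import measurable_realfun.
From mathcomp Require summability.
From mathcomp Require Import ring lra zify.

Set Implicit Arguments.
Unset Strict Implicit.
Unset Printing Implicit Defensive.

Import Order.TTheory GRing.Theory Num.Theory.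
Import numFieldNormedType.Exports.

Local Open Scope classical_set_scope.
Local Open Scope ring_scope.
Local Open Scope complex_scope.

(** * The sawtooth series and two series derived from it *)

Section sawtooth.
Variable R : realType.
Implicit Types (x y s a b : R) (n : nat).

Lemma mean_value_ineq (f df : R -> R) a b (B : R) :
  {in `[a, b], forall x, is_derive x 1 f (df x)} ->
  {in `[a, b], forall x, `|df x| <= B} ->
  {in `[a, b] &, forall x y, `|f x - f y| <= B * `|x - y|}.
Proof.
move=> fd fB.
suff H : {in `[a, b] &, forall x y, x <= y -> `|f x - f y| <= B * `|x - y|}.
  move=> x y xab yab; have [xy|/ltW yx] := leP x y; first exact: H.
  by rewrite distrC (distrC x); exact: H.
move=> x y; rewrite !in_itv/= => /andP[ax xb] /andP[ay yb] xy.
have sub : {subset `[x, y] <= `[a, b]}.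
  by apply: subitvP; rewrite subitvE !bnd_simp ax yb.
have [||c cxy E] := @MVT_segment R f df x y xy.
- move=> c cxy; apply: fd; apply: sub.
  by move: cxy; rewrite !in_itv/= => /andP[/ltW-> /ltW->].
- apply: derivable_within_continuous => c cxy.
  by have [] := fd c (sub _ cxy).
rewrite distrC E normrM (distrC x); apply: ler_wpM2r => //; apply: fB.
exact: sub.
Qed.

Lemma is_derive_sum_ord (h dh : nat -> R -> R) n x :
  (forall i, is_derive x 1 (h i) (dh i x)) ->
  is_derive x 1 (fun y => \sum_(i < n) h i y) (\sum_(i < n) dh i x).
Proof.
move=> hd; have := @is_derive_sum _ _ _ n (fun i => h i) x 1 (fun i => dh i x) hd.
by congr is_derive; apply/funext => y; rewrite fct_sumE.
Qed.

Lemma is_derive_inv (f : R -> R) df x : f x != 0 -> is_derive x 1 f df ->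
  is_derive x 1 (fun y => (f y)^-1) (- df / f x ^+ 2).
Proof.
move=> fx0 [fd fE]; split; first exact: derivableV.
by rewrite deriveV// fE [LHS]mulrC mulrN mulNr.
Qed.

(** Twice sin(x/2) cos(jx) is sin((j + 1/2)x) - sin((j - 1/2)x), so the sum telescopes. *)
Lemma dirichlet_kernel n x : 2 * sin (x / 2) * \sum_(i < n) cos (i.+1%:R * x) =
  sin ((n%:R + 2^-1) * x) - sin (x / 2).
Proof.
elim: n => [|n IHn].
  by rewrite big_ord0 mulr0 add0r (mulrC _^-1) subrr.
rewrite big_ord_recr/= mulrDr IHn.
have -> : (n%:R + 2^-1) * x = n.+1%:R * x - x / 2 by rewrite -natr1; field.
have -> : (n.+1%:R + 2^-1) * x = n.+1%:R * x + x / 2 by field.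
by rewrite sinB sinD; ring.
Qed.

Lemma sin_natpi n : sin (n%:R * pi) = 0 :> R.
Proof.
elim: n => [|n IHn]; first by rewrite mul0r sin0.
by rewrite -natr1 mulrDl mul1r sinDpi IHn oppr0.
Qed.

Definition sawtooth n x : R := \sum_(i < n) sin (i.+1%:R * x) / i.+1%:R.

Lemma is_derive_sawtooth n x :
  is_derive x 1 (sawtooth n) (\sum_(i < n) cos (i.+1%:R * x)).
Proof.
apply: (@is_derive_sum_ord (fun i y => sin (i.+1%:R * y) / i.+1%:R)
  (fun i y => cos (i.+1%:R * y))) => i.
apply: is_derive_eq.
rewrite /GRing.scale/=; field.
by rewrite nat1r pnatr_eq0.
Qed.

(** The sine is symmetric about pi/2, so on [d/2, pi - d/2] it is smallest at the endpoints. *)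
Lemma sin_half_ge d x : 0 < d < pi -> x \in `[d, 2 * pi - d] ->
  sin (d / 2) <= sin (x / 2).
Proof.
move=> /andP[d0 dpi]; rewrite in_itv/= => /andP[dx xd].
have [h|h] := lerP (x / 2) (pi / 2).
  by rewrite leNgt ltr_sin ?in_itv/= -?leNgt; lra.
have -> : sin (x / 2) = sin (pi - x / 2) by rewrite sinB sinpi cospi; ring.
by rewrite leNgt ltr_sin ?in_itv/= -?leNgt; lra.
Qed.

(** By the Dirichlet kernel the error has derivative sin((n + 1/2)x) / (2 sin(x/2)). As in an
    integration by parts, adding a term of size 1/n cancels this oscillation and leaves a derivative
    of size 1/n; the corrected error vanishes at pi. *)
Lemma sawtooth_bound d : 0 < d < pi -> exists K : R,
  forall n, {in `[d, 2 * pi - d], forall x,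
    `|sawtooth n x - (pi - x) / 2| <= K / n.+1%:R}.
Proof.
move=> dpi; set c := sin (d / 2).
have c0 : 0 < c by apply: sin_gt0_pi; lra.
(* The first summand bounds the variation of the corrected error [r] between x and pi, the second
   the correction itself. *)
exists (pi / c ^+ 2 + c^-1) => n x xd.
have n0 : 0 < (n%:R + 2^-1 : R) by rewrite ltr_wpDl.
pose e : R := (2 * (n%:R + 2^-1))^-1.
have e0 : 0 < e by rewrite invr_gt0; lra.
pose r (y : R) : R :=
  sawtooth n y - (pi - y) / 2 + e * (cos ((n%:R + 2^-1) * y) * (sin (y / 2))^-1).
pose dr y := - e * (cos ((n%:R + 2^-1) * y) * cos (y / 2)) / (2 * sin (y / 2) ^+ 2).
have sge y : y \in `[d, 2 * pi - d] -> c <= sin (y / 2) by exact: sin_half_ge.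
have rd : {in `[d, 2 * pi - d], forall y, is_derive y 1 r (dr y)}.
  move=> y yd; have sy := lt_le_trans c0 (sge _ yd).
  have sy0 : sin (y / 2) != 0 by rewrite gt_eqF.
  have := is_derive_sawtooth n y.
  have : is_derive y 1 (fun z => (sin (z / 2))^-1)
           (- (2^-1 * cos (y / 2)) / sin (y / 2) ^+ 2).
    apply: (@is_derive_inv (fun z => sin (z / 2))) => //.
    by apply: is_derive_eq; rewrite /GRing.scale/=; ring.
  move=> ? ?; apply: is_derive_eq.
  rewrite /GRing.scale/= /dr.
  have := dirichlet_kernel n y.
  set D := \sum_(i < n) _ => DE.
  have {DE}-> : D = (sin ((n%:R + 2^-1) * y) - sin (y / 2)) / (2 * sin (y / 2)).
    by rewrite -DE; field.
  rewrite /e; field.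
  by rewrite sy0/=; lra.
have drB : {in `[d, 2 * pi - d], forall y, `|dr y| <= e / (2 * c ^+ 2)}.
  move=> y yd; have sy := lt_le_trans c0 (sge _ yd).
  have q0 : 0 < 2 * sin (y / 2) ^+ 2 by rewrite mulr_gt0// exprn_gt0.
  rewrite /dr !mulNr normrN normrM (normrM e) (gtr0_norm e0).
  rewrite [X in _ * X]gtr0_norm ?invr_gt0//.
  apply: ler_pM => //.
  - by rewrite mulr_ge0// ltW.
  - by rewrite invr_ge0 ltW.
  - rewrite -[leRHS]mulr1 ler_pM2l// normrM mulr_ile1//.
    + by rewrite ler_norml cos_geN1 cos_le1.
    + by rewrite ler_norml cos_geN1 cos_le1.
  - rewrite lef_pV2 ?posrE ?mulr_gt0 ?exprn_gt0//.
    by rewrite ler_pM2l// lerXn2r ?sge// nnegrE ltW.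
have pid : pi \in `[d, 2 * pi - d] by rewrite in_itv/=; lra.
have := mean_value_ineq rd drB xd pid.
have -> : r pi = 0.
  have -> : r pi = sawtooth n pi + e * (cos (n%:R * pi + pi / 2)
    * (sin (pi / 2))^-1).
    by rewrite /r (mulrDl n%:R) (mulrC 2^-1 pi); ring.
  rewrite cosD cos_pihalf sin_pihalf.
  have -> : sin (n%:R * pi) = 0 :> R.
    exact: sin_natpi.
  have -> : sawtooth n pi = 0.
    rewrite /sawtooth big1// => i _.
    by rewrite sin_natpi mul0r.
  by rewrite mulr0 mul0r subr0 mul0r mulr0 addr0.
rewrite subr0 => rx.
have xpi : `|x - pi| <= pi.
  by move: xd; rewrite in_itv/= ler_norml; lra.
have : `|e * (cos ((n%:R + 2^-1) * x) * (sin (x / 2))^-1)| <= e * c^-1.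
  rewrite normrM (gtr0_norm e0) ler_pM2l// normrM.
  have sx := lt_le_trans c0 (sge _ xd).
  rewrite -[leRHS]mul1r; apply: ler_pM => //.
  - by rewrite ler_norml cos_geN1 cos_le1.
  - by rewrite gtr0_norm ?invr_gt0// lef_pV2 ?posrE//; exact: sge.
set E := e * _; move=> hE.
have -> : sawtooth n x - (pi - x) / 2 = r x - E by rewrite /r -/E; ring.
rewrite (le_trans (ler_normB _ _))//.
rewrite (le_trans (lerD rx hE))//.
have e1 : e <= n.+1%:R^-1.
  by rewrite lef_pV2 ?posrE// ?mulr_gt0//-natr1; have := ler0n R n; lra.
have : e / (2 * c ^+ 2) * `|x - pi| <= e * (pi / c ^+ 2).
  rewrite -mulrA ler_pM2l// invfM -mulrA mulrCA mulrC ler_pM2r//.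
    by rewrite (le_trans _ xpi)// ler_piMl// invf_le1// ler1n.
  by rewrite invr_gt0 exprn_gt0.
move=> /lerD/(_ (lexx (e / c)))/le_trans; apply.
rewrite -mulrDr mulrC ler_wpM2l// addr_ge0// ?divr_ge0 ?invr_ge0 ?sqr_ge0 ?pi_ge0//.
exact: ltW.
Qed.
End sawtooth.

(** * Sums of the cosine and sine series on (0, 2 pi) *)

Section cosine_sine_series.
Variable R : realType.
Implicit Types (x y s a b : R) (n : nat).

Lemma le0_at_right0 (f : R -> R) c : 0 < c -> {for 0, continuous f} ->
  {in `]0, c[, forall x, f x <= 0} -> f 0 <= 0.
Proof.
move=> c0 fc fle.
have f0 : f x @[x --> 0^'+] --> f 0 by apply: cvg_at_right_filter.
apply: (cvgr_to_le f0); near=> x; apply: fle.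
by rewrite in_itv/=; apply/andP; split; near: x;
  [exact: nbhs_right_gt|exact: nbhs_right_lt].
Unshelve. all: by end_near. Qed.

Lemma normr_sin_le x : `|sin x| <= `|x|.
Proof.
have sd : {in `[- `|x|, `|x|], forall y, is_derive y 1 sin (cos y)}.
  by move=> y _; exact: is_derive_sin.
have cB : {in `[- `|x|, `|x|], forall y, `|cos y| <= 1}.
  by move=> y _; rewrite ler_norml cos_geN1 cos_le1.
have xx : x \in `[- `|x|, `|x|] by rewrite in_itv/= -ler_norml.
have x0 : 0 \in `[- `|x|, `|x|] by rewrite in_itv/= -ler_norml normr0.
by have := mean_value_ineq sd cB xx x0; rewrite sin0 !subr0 mul1r.
Qed.

(* Dominates 1 / i^2 up to a constant and has explicit tails. *)
Definition telescope_weight (i : nat) : R := (i.+1%:R * i.+2%:R)^-1.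

Lemma telescope_weight_ge0 i : 0 <= telescope_weight i.
Proof. by rewrite invr_ge0 mulr_ge0. Qed.

Lemma series_telescope_weight n : series telescope_weight n = 1 - n.+1%:R^-1.
Proof.
rewrite /series/=; elim: n => [|n IHn]; first by rewrite big_geq// invr1 subrr.
rewrite big_nat_recr//= IHn /telescope_weight.
have : 0 < n.+1%:R :> R by [].
rewrite -(natr1 n.+1); move: (n.+1%:R : R) => a a0; field.
by rewrite !gt_eqF// addr_gt0.
Qed.

Lemma cvg_telescope_weight : series telescope_weight @ \oo --> (1 : R).
Proof.
rewrite (_ : series _ = fun n => 1 - n.+1%:R^-1); last first.
  by apply/funext => n; exact: series_telescope_weight.
rewrite -[X in _ --> X]subr0; apply: cvgB; first exact: cvg_cst.
exact: cvg_harmonic.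
Qed.

Lemma sqr_inv_le_telescope_weight i : (i.+1%:R ^+ 2)^-1 <= 2 * telescope_weight i.
Proof.
rewrite /telescope_weight -[2]invrK -invfM lef_pV2 ?posrE ?mulr_gt0 ?exprn_gt0//.
by rewrite -(natr1 i.+1) -(natr1 i); have := ler0n R i; nra.
Qed.

Section partial_fractions.
Variables (s K : R).
Hypothesis s0 : 0 < s.
(** A quantitative distance of s from the integers j >= 0: it gives 1/|j^2 - s^2| <= K/j^2 for j >
    0. *)
Hypothesis sK : forall j : nat, j%:R <= K * `|j%:R - s|.
Hypothesis sin_s : sin (pi * s) != 0.

Let K0 : 0 <= K.
Proof.
by have := sK 0; rewrite sub0r normrN gtr0_norm// pmulr_lge0.
Qed.

Lemma sqr_le_dist_sqr (j : nat) : j%:R ^+ 2 <= K * `|j%:R ^+ 2 - s ^+ 2|.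
Proof.
rewrite subr_sqr normrM mulrA expr2; apply: ler_pM => //.
by rewrite ger0_norm ?addr_ge0 ?lerDl ?(ltW s0).
Qed.

Lemma sqr_dist_neq0 (j : nat) : j.+1%:R ^+ 2 - s ^+ 2 != 0.
Proof.
apply/eqP => E; have := sqr_le_dist_sqr j.+1.
by rewrite E normr0 mulr0 leNgt exprn_gt0.
Qed.

(** The coefficients are 1/(j - s) - 1/(j + s) and 1/(j - s) + 1/(j + s) - 2/j. Removing 2/j, which
    contributes twice the sawtooth, makes the sine series absolutely convergent. *)
Definition cosS n x := \sum_(i < n) 2 * s / (i.+1%:R ^+ 2 - s ^+ 2)
  * cos (i.+1%:R * x).
Definition sinS n x := \sum_(i < n)
  2 * s ^+ 2 / (i.+1%:R * (i.+1%:R ^+ 2 - s ^+ 2)) * sin (i.+1%:R * x).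
(* The sums of the two series for 0 < x < 2 pi. *)
Definition cosL x := s^-1 - pi * cos (s * (x - pi)) / sin (pi * s).
Definition sinL x := x - pi - pi * sin (s * (x - pi)) / sin (pi * s).

(** Since j/(j^2 - s^2) = 1/j + s^2/(j (j^2 - s^2)), differentiation returns the sine series plus a
    multiple of the sawtooth, the forcing term of the system. *)
Lemma is_derive_cosS n x :
  is_derive x 1 (cosS n) (- s * sinS n x - 2 * s * sawtooth n x).
Proof.
have -> : - s * sinS n x - 2 * s * sawtooth n x = \sum_(i < n)
    2 * s / (i.+1%:R ^+ 2 - s ^+ 2) * (- i.+1%:R * sin (i.+1%:R * x)).
  rewrite !mulr_sumr -sumrB; apply: eq_bigr => i _.
  have := sqr_dist_neq0 i; have : i.+1%:R != 0 :> R by rewrite pnatr_eq0.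
  by move: (i.+1%:R : R) => j j0 d0; field; rewrite ?d0 ?j0.
apply: (@is_derive_sum_ord R
  (fun i y => 2 * s / (i.+1%:R ^+ 2 - s ^+ 2) * cos (i.+1%:R * y))
  (fun i x => 2 * s / (i.+1%:R ^+ 2 - s ^+ 2)
    * (- i.+1%:R * sin (i.+1%:R * x))) n x) => i.
by apply: is_derive_eq; rewrite /GRing.scale/=; ring.
Qed.

Lemma is_derive_sinS n x : is_derive x 1 (sinS n) (s * cosS n x).
Proof.
rewrite mulr_sumr.
apply: (@is_derive_sum_ord R
  (fun i y => 2 * s ^+ 2 / (i.+1%:R * (i.+1%:R ^+ 2 - s ^+ 2)) * sin (i.+1%:R * y))
  (fun i x => s * (2 * s / (i.+1%:R ^+ 2 - s ^+ 2) * cos (i.+1%:R * x)))) => i.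
apply: is_derive_eq; rewrite /GRing.scale/=.
have := sqr_dist_neq0 i; have : i.+1%:R != 0 :> R by rewrite pnatr_eq0.
by move: (i.+1%:R : R) => j j0 d0; field; rewrite ?d0 ?j0.
Qed.

(* (cosS - cosL, sinS - sinL) rotated by the angle s (x - pi): this makes the
   derivatives small, because they involve only the error term [err]. *)
Let rotA n x := (cosS n x - cosL x) * cos (s * (x - pi)) +
  (sinS n x - sinL x) * sin (s * (x - pi)).
Let rotB n x := (sinS n x - sinL x) * cos (s * (x - pi)) -
  (cosS n x - cosL x) * sin (s * (x - pi)).
Let err n x := sawtooth n x - (pi - x) / 2.

(** [cosL] and [sinL] solve the same system with (pi - x)/2 in place of the sawtooth. The
    differences are therefore forced by [err] alone, and the rotation removes the homogeneous
    part. *)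
Lemma is_derive_rotA n x :
  is_derive x 1 (rotA n) (- 2 * s * err n x * cos (s * (x - pi))).
Proof.
have := is_derive_cosS n x; have := is_derive_sinS n x => ? ?.
rewrite /rotA /cosL /sinL.
apply: is_derive_eq; rewrite /GRing.scale/= /err.
by field; rewrite sin_s gt_eqF.
Qed.

Lemma is_derive_rotB n x :
  is_derive x 1 (rotB n) (2 * s * err n x * sin (s * (x - pi))).
Proof.
have := is_derive_cosS n x; have := is_derive_sinS n x => ? ?.
rewrite /rotB /cosL /sinL.
apply: is_derive_eq; rewrite /GRing.scale/= /err.
by field; rewrite sin_s gt_eqF.
Qed.

(** Both x and pi lie in a compact interval where [err] is O(1/n), so the mean value inequality
    applies between them. *)
Let rot_cvg (f df : nat -> R -> R) :
  (forall n x, is_derive x 1 (f n) (df n x)) ->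
  (forall n x, `|df n x| <= 2 * s * `|err n x|) ->
  {in `]0, 2 * pi[, forall x, f n x - f n pi @[n --> \oo] --> (0 : R)}.
Proof.
move=> fd dfB x; rewrite in_itv/= => /andP[x0 x2pi].
(* Half the distance from x to the ends of (0, 2 pi), so that x and pi lie in [d, 2 pi - d]. *)
pose d := Num.min x (2 * pi - x) / 2.
have [K1 errB] : exists K1, forall n, {in `[d, 2 * pi
  - d], forall y, `|err n y| <= K1 / n.+1%:R}.
  apply: sawtooth_bound; rewrite /d minElt; case: ifPn; first lra.
  rewrite -leNgt; lra.
have H n : `|f n x - f n pi| <= 2 * s * (K1 / n.+1%:R) * `|x - pi|.
  apply: (@mean_value_ineq _ _ (df n) d (2 * pi - d)) => //.
  - move=> y yd; apply: le_trans (dfB n y) _.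
    by rewrite ler_pM2l ?mulr_gt0//; exact: errB.
  - rewrite in_itv/= /d minElt; case: ifPn; first lra.
    rewrite -leNgt; lra.
  - rewrite in_itv/= /d minElt; case: ifPn; first lra.
    rewrite -leNgt; lra.
apply/norm_cvg0P.
apply: (@squeeze_cvgr _ _ _ _ (cst 0) (fun n =>
  2 * s * (K1 / n.+1%:R) * `|x - pi|)).
- by near=> n; rewrite normr_ge0 H.
- exact: cvg_cst.
- rewrite (_ : 0 = 2 * s * (K1 * 0) * `|x - pi|); last by rewrite !mulr0 mul0r.
  apply: cvgM; last exact: cvg_cst.
  apply: cvgM; first exact: cvg_cst.
  apply: cvgM; first exact: cvg_cst.
  exact: cvg_harmonic.
Unshelve. all: by end_near. Qed.

Lemma normr_cosS_coef i : `|2 * s / (i.+1%:R ^+ 2 - s ^+ 2)| <=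
  4 * s * K * telescope_weight i.
Proof.
rewrite normrM (ger0_norm (mulr_ge0 _ (ltW s0)))// normfV.
have H := sqr_le_dist_sqr i.+1.
have D0 : 0 < `|i.+1%:R ^+ 2 - s ^+ 2| by rewrite normr_gt0 sqr_dist_neq0.
rewrite ler_pdivrMr//.
have := sqr_inv_le_telescope_weight i.
have j0 : 0 < i.+1%:R ^+ 2 :> R by rewrite exprn_gt0.
rewrite -[leLHS]div1r ler_pdivrMr// => T.
have := ler_wpM2l (telescope_weight_ge0 i) H.
have := telescope_weight_ge0 i.
move: T; set w := telescope_weight i; set D := `|_|; set J := _ ^+ 2 => T w0 H2.
rewrite (_ : 4 * s * K * w * D = 2 * s * (2 * (w * (K * D)))); last by ring.
by rewrite -[leLHS]mulr1 ler_pM2l ?mulr_gt0//; lra.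
Qed.

(** The bound |sin(jx)| <= j|x| absorbs the factor 1/j and leaves the summable coefficients of
    [cosS]. Being uniform in n, the estimate passes to the limit. *)
Lemma normr_sinS_le n x : `|sinS n x| <= 4 * s ^+ 2 * K * `|x|.
Proof.
have -> : 4 * s ^+ 2 * K * `|x| = 4 * s * K * 1 * (s * `|x|) by ring.
apply: (@le_trans _ _ (\sum_(i < n)
  4 * s * K * telescope_weight i * (s * `|x|))); last first.
  rewrite -mulr_suml -mulr_sumr ler_wpM2r ?mulr_ge0 ?(ltW s0)// ler_wpM2l
    ?mulr_ge0 ?(ltW s0)//.
  have := series_telescope_weight n; rewrite /series/= big_mkord => ->.
  by rewrite lerBlDr lerDl invr_ge0.
apply: le_trans (ler_norm_sum _ _ _) _; apply: ler_sum => i _.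
have -> : 2 * s ^+ 2 / (i.+1%:R * (i.+1%:R ^+ 2 - s ^+ 2)) * sin (i.+1%:R * x) =
   2 * s / (i.+1%:R ^+ 2 - s ^+ 2) * (s * (sin (i.+1%:R * x) / i.+1%:R)).
  have := sqr_dist_neq0 i; have : i.+1%:R != 0 :> R by rewrite pnatr_eq0.
  by move: (i.+1%:R : R) => j j0 d0; field; rewrite ?d0 ?j0.
rewrite normrM; apply: ler_pM => //; first exact: normr_cosS_coef.
rewrite normrM (gtr0_norm s0) ler_pM2l// normrM normfV.
rewrite ler_pdivrMr ?normr_gt0 ?pnatr_eq0//.
by rewrite -normrM mulrC normr_sin_le.
Qed.

Lemma is_cvg_cosS x : cvgn (cosS ^~ x).
Proof.
have -> : cosS^~ x = series (fun i =>
  2 * s / (i.+1%:R ^+ 2 - s ^+ 2) * cos (i.+1%:R * x)).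
  by apply/funext => n; rewrite /series/= big_mkord.
apply: normed_cvg.
apply: (@series_le_cvg _ _ (4 * s * K *: (telescope_weight : nat -> R))) => //=.
- by move=> n; rewrite mulr_ge0 ?telescope_weight_ge0// !mulr_ge0// ltW.
- move=> n; apply: le_trans (normr_cosS_coef n).
  rewrite normrM -[leRHS]mulr1 ler_pM2l ?normr_gt0.
    by rewrite ler_norml cos_geN1 cos_le1.
  by rewrite mulf_neq0 ?invr_eq0 ?sqr_dist_neq0// mulf_neq0// gt_eqF.
- apply: is_cvg_seriesZ; apply/cvg_ex; exists 1; exact: cvg_telescope_weight.
Qed.

Let rotB_pi n : rotB n pi = 0.
Proof.
rewrite /rotB subrr mulr0 sin0 mulr0 subr0 cos0 mulr1 /sinL !subrr mulr0 sin0
  mulr0 mul0r !subr0.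
by rewrite /sinS big1// => i _; rewrite sin_natpi mulr0.
Qed.

Let rotA_pi n : rotA n pi = cosS n pi - cosL pi.
Proof. by rewrite /rotA subrr mulr0 sin0 mulr0 addr0 cos0 mulr1. Qed.

Let rotB_cvg x : x \in `]0, 2 * pi[ -> rotB n x @[n --> \oo] --> (0 : R).
Proof.
move=> xpi; have := rot_cvg is_derive_rotB _ xpi.
under eq_fun do rewrite rotB_pi subr0.
apply => n y; rewrite normrM normrM (gtr0_norm (mulr_gt0 _ s0))//.
rewrite -[leRHS]mulr1 ler_wpM2l// ?sin_max//.
by rewrite mulr_ge0// mulr_ge0// ltW.
Qed.

Let rotA_cvg x : x \in `]0, 2 * pi[ ->
  rotA n x @[n --> \oo] --> limn (cosS ^~ pi) - cosL pi.
Proof.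
move=> xpi; have H : rotA n x - rotA n pi @[n --> \oo] --> (0 : R).
  have := rot_cvg is_derive_rotA _ xpi; apply=> n y.
  rewrite normrM normrM mulNr normrN (gtr0_norm (mulr_gt0 _ s0))//.
  rewrite -[leRHS]mulr1 ler_wpM2l//.
    by rewrite mulr_ge0// mulr_ge0// ltW.
  by rewrite ler_norml cos_geN1 cos_le1.
have Hpi : rotA n pi @[n --> \oo] --> limn (cosS ^~ pi) - cosL pi.
  under eq_fun do rewrite rotA_pi.
  by apply: cvgB; [exact: is_cvg_cosS|exact: cvg_cst].
rewrite -[X in _ --> X]add0r.
rewrite (_ : rotA ^~ x = (fun n => rotA n x - rotA n pi) \+ (rotA ^~ pi)).
  exact: cvgD H Hpi.
by apply/funext => n; rewrite /= subrK.
Qed.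

(** The rotation undone, by cos^2 + sin^2 = 1. *)
Let cosSE n x : cosS n x = rotA n x * cos (s * (x - pi))
  - rotB n x * sin (s * (x - pi)) + cosL x.
Proof.
rewrite /rotA /rotB; have := cos2Dsin2 (s * (x - pi)).
set c := cos _; set d := sin _ => H.
transitivity ((cosS n x - cosL x) * (c ^+ 2 + d ^+ 2) + cosL x); last by ring.
by rewrite H; ring.
Qed.

Let sinSE n x : sinS n x = rotA n x * sin (s * (x - pi))
  + rotB n x * cos (s * (x - pi)) + sinL x.
Proof.
rewrite /rotA /rotB; have := cos2Dsin2 (s * (x - pi)).
set c := cos _; set d := sin _ => H.
transitivity ((sinS n x - sinL x) * (c ^+ 2 + d ^+ 2) + sinL x); last by ring.
by rewrite H; ring.
Qed.

(* The constant is read off at 0, where sinS n vanishes. *)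
Let lim_rotA0 : limn (cosS ^~ pi) - cosL pi = 0.
Proof.
set k : R := _ - _.
pose h : R -> R := fun x => k * sin (s * (x - pi)) + sinL x.
have hc : {for 0, continuous h}.
  apply: differentiable_continuous; apply/derivable1_diffP.
  have hd : is_derive (0 : R) 1 h (k * (s * cos (s * (0 - pi))) + 1 -
      pi * (s * cos (s * (0 - pi))) / sin (pi * s)).
    by rewrite /h /sinL; apply: is_derive_eq; rewrite /GRing.scale/=; ring.
  by case: hd.
(* In the limit the bound on [sinS] makes [f] nonpositive to the right of 0, and continuity carries
   this to 0. *)
pose f x := `|h x| - 4 * s ^+ 2 * K * `|x|.
have : f 0 <= 0.
  apply: (@le0_at_right0 _ (2 * pi)); first by rewrite mulr_gt0// pi_gt0.
    apply: cvgB.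
      exact: (cvg_norm hc).
    by apply: cvgM; [exact: cvg_cst|exact: (cvg_norm cvg_id)].
  move=> x xpi; rewrite /f /h subr_le0.
  have : `|sinS n x| @[n --> \oo] --> `|k * sin (s * (x - pi)) + sinL x|.
    apply: cvg_norm; under eq_fun do rewrite sinSE.
    have H : rotA n x * sin (s * (x - pi)) + rotB n x * cos (s * (x - pi)) + sinL x
        @[n --> \oo] --> k * sin (s * (x - pi)) + 0 * cos (s * (x - pi)) + sinL x.
      apply: cvgD; last exact: cvg_cst.
      apply: cvgD; apply: cvgM; try exact: cvg_cst.
        exact: rotA_cvg.
      exact: rotB_cvg.
    by move: H; rewrite mul0r addr0.
  move=> /cvgr_to_le; apply; near=> n; exact: normr_sinS_le.
(* [sinL] vanishes at 0, so only k sin(pi s) remains, and sin(pi s) is nonzero. *)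
have h0 : h 0 = - (k * sin (pi * s)).
  rewrite /h /sinL (_ : s * (0 - pi) = - (pi * s)); last by ring.
  by rewrite sinN; field.
by rewrite /f h0 normr0 mulr0 subr0 normrN normr_le0 mulf_eq0 (negbTE sin_s)
  orbF => /eqP.
Unshelve. all: by end_near. Qed.

Lemma cvg_cosS x : x \in `]0, 2 * pi[ -> cosS n x @[n --> \oo] --> cosL x.
Proof.
move=> xpi; under eq_fun do rewrite cosSE.
have H : rotA n x * cos (s * (x - pi)) - rotB n x * sin (s * (x - pi)) + cosL x
    @[n --> \oo] --> 0 * cos (s * (x - pi)) - 0 * sin (s * (x - pi)) + cosL x.
  apply: cvgD; last exact: cvg_cst.
  apply: cvgB; apply: cvgM; try exact: cvg_cst.
    by rewrite -lim_rotA0; exact: rotA_cvg.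
  exact: rotB_cvg.
by move: H; rewrite !mul0r subrr add0r.
Qed.

Lemma cvg_sinS x : x \in `]0, 2 * pi[ -> sinS n x @[n --> \oo] --> sinL x.
Proof.
move=> xpi; under eq_fun do rewrite sinSE.
have H : rotA n x * sin (s * (x - pi)) + rotB n x * cos (s * (x - pi)) + sinL x
    @[n --> \oo] --> 0 * sin (s * (x - pi)) + 0 * cos (s * (x - pi)) + sinL x.
  apply: cvgD; last exact: cvg_cst.
  apply: cvgD; apply: cvgM; try exact: cvg_cst.
    by rewrite -lim_rotA0; exact: rotA_cvg.
  exact: rotB_cvg.
by move: H; rewrite !mul0r addr0 add0r.
Qed.
End partial_fractions.
End cosine_sine_series.

(** * Combinations of indicator functions of intervals *)

Section integrable_series.
Context d (T : measurableType d) (R : realType) (mu : {measure set T -> \bar R}).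

(** Dominated convergence: the partial sums are dominated by the sum of the |u_i|, whose integral is
    at most the sum of the c_i by monotone convergence. *)
Lemma integrable_series (u : nat -> T -> R) (c : nat -> R) :
  (forall i, mu.-integrable setT (EFin \o u i)) ->
  (forall i, \int[mu]_x `|u i x| <= c i) -> cvgn (series c) ->
  (forall x, cvgn (series (fun i => `|u i x|))) ->
  mu.-integrable setT (EFin \o (fun x => limn (series (u ^~ x)))) /\
  series (fun i => \int[mu]_x u i x) @ \oo -->
    \int[mu]_x limn (series (u ^~ x)).
Proof.
move=> ui uc cc ucvg.
have um i : measurable_fun setT (u i).
  by have := measurable_int _ (ui i); move/measurable_EFinP.
have um' i : measurable_fun setT (fun x => (`|u i x|)%:E).
  by apply/measurable_EFinP; exact: measurableT_comp.
pose f n x := (series (u ^~ x) n)%:E.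
pose g x := (\sum_(0 <= i <oo) (`|u i x|)%:E)%E.
have fm n : measurable_fun setT (f n).
  by apply/measurable_EFinP; rewrite /series/=; exact: measurable_sum.
have gi : mu.-integrable setT g.
  apply/integrableP; split.
    by apply: ge0_emeasurable_sum.
  under eq_integral => x _.
    rewrite gee0_abs; last by apply: nneseries_ge0.
    over.
  rewrite integral_nneseries//.
  apply: (@le_lt_trans _ _ (\sum_(0 <= i <oo) (c i)%:E)%E); last first.
    have : (\sum_(0 <= i <oo) (c i)%:E)%E = (limn (series c))%:E.
      apply/cvg_lim => //; apply: cvg_EFin.
        by near=> n; rewrite sumEFin.
      under eq_fun do rewrite sumEFin.
      exact: cc.
    by move=> ->; rewrite ltry.
  apply: lee_nneseries => [i _ _|i _]; first exact: integral_ge0.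
  have /(integrable_fin_num measurableT) := integrable_abse (ui i).
  by move=> /fineK <-; rewrite lee_fin; exact: uc.
have ulim x : f ^~ x @ \oo --> (limn (series (u ^~ x)))%:E.
  apply: cvg_EFin; first by near=> n.
  have := normed_cvg (ucvg x); exact: id.
have [|||||lu _ H] := @dominated_convergence _ T R mu setT measurableT f
  (EFin \o (fun x => limn (series (u ^~ x)))) g => //.
- by apply: emeasurable_fun_cvg fm _ => x _; exact: ulim.
- by apply: aeW => x _; exact: ulim.
- apply: aeW => x n _; apply: (@le_trans _ _ (\sum_(0 <= i < n) (`|u i x|)%:E)%E).
    by rewrite sumEFin lee_fin; exact: ler_norm_sum.
  exact: nneseries_lim_ge.
split=> //.
have /fine_cvgP[_] : (fun n => \int[mu]_x f n x)%E @ \oo -->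
  (\int[mu]_x limn (series (u ^~ x)))%:E.
  by rewrite fineK//; exact: integrable_fin_num.
rewrite (_ : fine \o _ = series (fun i => \int[mu]_x u i x))//.
apply/funext => n /=.
under eq_integral do rewrite /f /series/= -sumEFin.
rewrite (integral_sum measurableT ui) /series/=.
rewrite (eq_bigr (fun i => (\int[mu]_x u i x)%:E)) ?sumEFin// => i _.
by rewrite fineK//; exact: (integrable_fin_num measurableT (ui i)).
Unshelve. all: by end_near. Qed.
End integrable_series.

(** * Averages over short intervals and series of boxes *)

Section box_functions.
Variable R : realType.
Implicit Types (x y s a b e p M : R) (n : nat) (z : R -> R).
Local Notation mu := (@lebesgue_measure R).

Lemma continuous_itv_integrable z a b : continuous z ->
  mu.-integrable `[a, b] (EFin \o z).
Proof.
move=> zc; apply: continuous_compact_integrable; first exact: segment_compact.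
by apply: continuous_subspaceT => x; exact: zc.
Qed.

Lemma continuous_shift_arg z p : continuous z -> continuous (fun u => z (p + u)).
Proof.
move=> zc u; apply: (@continuous_comp _ _ _ (fun u => p + u) z).
  by apply: cvgD; [exact: cvg_cst|exact: cvg_id].
exact: zc.
Qed.

Lemma Rintegral_itv_shift z p e : 0 <= e -> continuous z ->
  \int[mu]_(x in `[p, p + e]) z x = \int[mu]_(u in `[0, e]) z (p + u).
Proof.
move=> e0 zc; have shE : (fun u => p + u)^`()%classic = cst 1 :> (R -> R).
  apply/funext => u; rewrite derive1E.
  by have -> := @derive_val _ _ _ _ _ _ _ (is_deriveD (is_derive_cst p u 1)
    (is_derive_id u 1)); rewrite add0r.
rewrite /Rintegral; congr fine.
rewrite -{1}[p]addr0.
rewrite (@integration_by_substitution_increasing _ (fun u => p + u) z 0 e)//.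
- apply: eq_integral => u _; rewrite shE /=.
  by congr EFin; rewrite fctE/= mulr1.
- by move=> u v _ _ uv; rewrite ltrD2l.
- by rewrite shE => u _; exact: cvg_cst.
- by rewrite shE; exact: is_cvg_cst.
- by rewrite shE; exact: is_cvg_cst.
- have shc : continuous (fun u => p + u).
    by move=> u; apply: cvgD; [exact: cvg_cst|exact: cvg_id].
  split.
  + by move=> u _; apply: derivableD; [exact: derivable_cst|exact: derivable_id].
  + by apply: cvg_at_right_filter; exact: shc.
  + by apply: cvg_at_left_filter; exact: shc.
- by apply: continuous_subspaceT => u; exact: zc.
Qed.

Lemma Rintegral_itv_cst a e : 0 <= e -> \int[mu]_(u in `[0, e]) a = a * e.
Proof.
move=> e0; rewrite Rintegral_cst//; congr (_ * _).
suff H : mu `[0, e] = e%:E by exact: (congr1 fine H).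
rewrite lebesgue_measure_itv/= lte_fin.
by move: e0; rewrite le_eqVlt => /predU1P[<-|->]; rewrite ?ltxx// oppr0 adde0.
Qed.

Lemma cvg_average z : continuous z ->
  k.+1%:R * \int[mu]_(u in `[0, k.+1%:R^-1]) z u @[k --> \oo] --> z 0.
Proof.
move=> zc; apply/cvgrPdist_le => eta eta0.
have := zc 0 => /cvgrPdist_le /(_ _ eta0) [d/= d0 dz].
have : \forall k \near \oo, k.+1%:R^-1 < d.
  have := @cvg_harmonic R => /cvgr_lt; apply; exact: d0.
apply: filterS => k kd.
set e := k.+1%:R^-1 in kd *; have e0 : 0 < e by rewrite invr_gt0.
have kE : k.+1%:R = e^-1 by rewrite /e invrK.
rewrite kE -[z 0 in X in X <= _](mulKf (lt0r_neq0 e0)) -mulrBr.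
rewrite normrM gtr0_norm ?invr_gt0// ler_pdivrMl//.
rewrite mulrC -Rintegral_itv_cst ?(ltW e0)//.
rewrite -RintegralB//; last exact: continuous_itv_integrable.
  apply: le_trans (le_normr_Rintegral _ _) _ => //.
    by apply: continuous_itv_integrable => u; apply: cvgB;
      [exact: cvg_cst|exact: zc].
  rewrite mulrC -Rintegral_itv_cst ?(ltW e0)//; apply: le_Rintegral => //.
  - by apply: continuous_itv_integrable => u; apply: cvg_norm; apply: cvgB;
    [exact: cvg_cst|exact: zc].
  - by apply: continuous_itv_integrable => u; exact: cvg_cst.
  - move=> u; rewrite /= in_itv/= => /andP[u0 ue].
    by apply: dz; rewrite /= sub0r normrN ger0_norm// (le_lt_trans ue).
by apply: continuous_itv_integrable => u; exact: cvg_cst.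
Qed.

Definition box e p : R -> R := \1_`[p, p + e].

Lemma mul_box z e p : (fun x => z x * box e p x) = z \_ `[p, p + e].
Proof. by rewrite patch_indic. Qed.

Lemma integrable_mul_box z e p : continuous z ->
  mu.-integrable setT (EFin \o (fun x => z x * box e p x)).
Proof.
move=> zc; rewrite mul_box.
have := continuous_itv_integrable p (p + e) zc.
by rewrite integrable_mkcond//= restrict_EFin.
Qed.

Lemma Rintegral_mul_box z e p : 0 <= e -> continuous z ->
  \int[mu]_x (z x * box e p x) = \int[mu]_(u in `[0, e]) z (p + u).
Proof.
by move=> e0 zc; rewrite -Rintegral_itv_shift// [RHS]Rintegral_mkcond mul_box.
Qed.

Section box_combination.
Variables (al be p q b : nat -> R).
Hypothesis alb : forall i, `|al i| + `|be i| <= b i.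
Hypothesis cb : cvgn (series b).

(* There are two sequences of nodes so that the integers m + i and m - i can be
   paired, and the node t put in the slot left free by i = 0. *)
Definition box_comb e i x := al i * box e (p i) x + be i * box e (q i) x.
Definition box_series e x := limn (series (box_comb e ^~ x)).

Let b0 i : 0 <= b i.
Proof. by apply: le_trans (alb i); rewrite addr_ge0. Qed.

Lemma normr_box_le1 e c x : `|box e c x| <= 1.
Proof. by rewrite /box indicE; case: (_ \in _); rewrite ?normr1// normr0. Qed.

Lemma cvg_box_series e x : cvgn (series (fun i => `|box_comb e i x|)).
Proof.
apply: (series_le_cvg _ b0 _ cb) => // i.
apply: le_trans (ler_normD _ _) _; apply: le_trans (alb i).
by apply: lerD; rewrite normrM ler_piMr// normr_box_le1.
Qed.

Let zbox z e i x := z x * box_comb e i x.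

Let zboxE z e i : zbox z e i =
  (fun x => al i * (z x * box e (p i) x) + be i * (z x * box e (q i) x)).
Proof. by apply/funext => x; rewrite /zbox /box_comb; ring. Qed.

Let integrable_zbox z e i : continuous z ->
  mu.-integrable setT (EFin \o zbox z e i).
Proof.
move=> zc; rewrite zboxE.
have H c u : mu.-integrable setT (EFin \o (fun x => c * (z x * box e u x))).
  by apply: (@integrableZl _ _ _ mu setT measurableT c _ (integrable_mul_box e
    u zc)).
exact: (@integrableD _ _ _ mu setT measurableT _ _ (H (al i) (p i)) (H (be i)
  (q i))).
Qed.

Let Rintegral_zbox z e i : 0 <= e -> continuous z -> \int[mu]_x zbox z e i x =
  al i * \int[mu]_(u in `[0, e]) z (p i + u) + be i * \int[mu]_(u in `[0, e])
    z (q i + u).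
Proof.
move=> e0 zc; rewrite zboxE.
have H c u : mu.-integrable setT (EFin \o (fun x => c * (z x * box e u x))).
  by apply: (@integrableZl _ _ _ mu setT measurableT c _ (integrable_mul_box e
    u zc)).
rewrite RintegralD//.
by rewrite !RintegralZl ?Rintegral_mul_box//; exact: integrable_mul_box.
Qed.

Lemma normr_Rintegral_itv_le z M c e : 0 <= e -> continuous z ->
  (forall x, `|z x| <= M) ->
  `|\int[mu]_(u in `[0, e]) z (c + u)| <= M * e.
Proof.
move=> e0 zc zM; have zc' := @continuous_shift_arg z c zc.
apply: le_trans (le_normr_Rintegral _ _) _ => //;
  first exact: continuous_itv_integrable.
rewrite -Rintegral_itv_cst//; apply: le_Rintegral => //.
- by apply: continuous_itv_integrable => u; apply: cvg_norm; exact: zc'.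
- by apply: continuous_itv_integrable => u; exact: cvg_cst.
Qed.

Let Rintegral_norm_zbox z M e i : 0 <= e -> continuous z ->
  (forall x, `|z x| <= M) ->
  \int[mu]_x `|zbox z e i x| <= M * e * b i.
Proof.
move=> e0 zc zM.
have M0 : 0 <= M by apply: le_trans (zM 0).
have cM : continuous (cst M : R -> R) by move=> u; exact: cvg_cst.
have H c u : mu.-integrable setT (EFin \o (fun x => c * (M * box e u x))).
  by apply: (@integrableZl _ _ _ mu setT measurableT c _ (integrable_mul_box e
    u cM)).
pose g x := `|al i| * (M * box e (p i) x) + `|be i| * (M * box e (q i) x).
have gi : mu.-integrable setT (EFin \o g).
  exact: (@integrableD _ _ _ mu setT measurableT _ _ (H `|al i| (p i))
    (H `|be i| (q i))).
apply: (@le_trans _ _ (\int[mu]_x g x)).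
  apply: le_Rintegral => //.
    exact: (integrable_abse (integrable_zbox e i zc)).
  move=> x _; rewrite zboxE /g; apply: le_trans (ler_normD _ _) _.
  have boxN c u : `|c * (z x * box e u x)| <= `|c| * (M * box e u x).
    rewrite normrM ler_wpM2l// normrM ler_pM//.
    by rewrite /box indicE; case: (_ \in _); rewrite ?normr1// normr0.
  by apply: lerD.
rewrite /g RintegralD//.
have IZ c u : \int[mu]_x (c * (M * box e u x)) = c * (M * e).
  transitivity (c * \int[mu]_x (cst M x * box e u x)).
    by apply: RintegralZl => //; exact: (integrable_mul_box e u cM).
  by rewrite Rintegral_mul_box// Rintegral_itv_cst.
rewrite !IZ -mulrDl mulrC ler_wpM2l//.
by rewrite mulr_ge0.
Qed.

(** Termwise integration, with [M * e * b i] as the summable bound on the i-th integral. It is used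
    with the signal, with trigonometric functions and with the constant 1. *)
Lemma box_series_integral z M e : 0 <= e -> continuous z ->
  (forall x, `|z x| <= M) ->
  mu.-integrable setT (EFin \o (fun x => z x * box_series e x)) /\
  series (fun i => al i * \int[mu]_(u in `[0, e]) z (p i + u) +
    be i * \int[mu]_(u in `[0, e]) z (q i + u)) @ \oo -->
  \int[mu]_x (z x * box_series e x).
Proof.
move=> e0 zc zM.
have zY : (fun x => z x * box_series e x) = (fun x =>
  limn (series (zbox z e ^~ x))).
  apply/funext => x; apply/esym/cvg_lim => //.
  rewrite (_ : series _ = fun n => z x * series (box_comb e ^~ x) n); last first.
    by apply/funext => n; rewrite /series/= mulr_sumr.
  apply: cvgM; first exact: cvg_cst.
  have := normed_cvg (@cvg_box_series e x); exact.
rewrite zY.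
have -> : (fun i => al i * \int[mu]_(u in `[0, e]) z (p i + u) +
    be i * \int[mu]_(u in `[0, e]) z (q i + u)) = (fun i =>
      \int[mu]_x zbox z e i x).
  by apply/funext => i; rewrite Rintegral_zbox.
apply: (@integrable_series _ _ _ mu (zbox z e) (fun i => M * e * b i)).
- by move=> i; exact: integrable_zbox.
- by move=> i; exact: Rintegral_norm_zbox.
- by have : cvgn (series ((M * e) *: (b : R^o ^nat))) by exact: is_cvg_seriesZ.
- move=> x; apply: (@series_le_cvg _ _ (fun i => `|z x| * `|box_comb e i x|)) => //.
  + by move=> i; rewrite /zbox normrM.
  + have H := @cvg_box_series e x.
    by have : cvgn (series (`|z x| *: ((fun i => `|box_comb e i x|) :
      R^o ^nat))) by exact: is_cvg_seriesZ.
Qed.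

Lemma integrable_box_series e : 0 <= e ->
  mu.-integrable setT (EFin \o box_series e).
Proof.
move=> e0; have c1 : continuous (cst 1 : R -> R) by move=> u; exact: cvg_cst.
have [|+ _] := @box_series_integral (cst 1) 1 e e0 c1.
  by move=> x; rewrite normr1.
congr integrable; apply/funext => x /=.
by rewrite mul1r.
Qed.

(* The n-th partial sum is at most M times the n-th tail of b: this holds for
   averages over intervals of length e, and the bound does not depend on e. *)
Lemma vanishing_box_combination z M : continuous z -> (forall x, `|z x| <= M) ->
  (forall e, 0 < e -> \int[mu]_x (z x * box_series e x) = 0) ->
  series (fun i => al i * z (p i) + be i * z (q i)) @ \oo --> (0 : R).
Proof.
move=> zc zM zY; have M0 : 0 <= M by apply: le_trans (zM 0).
pose B := limn (series b).
pose I e c := \int[mu]_(u in `[0, e]) z (c + u).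
pose J e i := al i * I e (p i) + be i * I e (q i).
have Jb e i : 0 < e -> `|J e i| <= M * e * b i.
  move=> /ltW e0; apply: le_trans (ler_normD _ _) _.
  rewrite !normrM (@le_trans _ _ ((`|al i| + `|be i|) * (M * e)))//.
    by rewrite mulrDl; apply: lerD; apply: ler_wpM2l => //;
      exact: normr_Rintegral_itv_le.
  by rewrite mulrC ler_wpM2l// mulr_ge0.
(* The whole series sums to 0, so a partial sum is the opposite of a tail. *)
have tail e n : 0 < e -> `|series (J e) n| <= M * e * (B - series b n).
  move=> e0; have [_] := box_series_integral (ltW e0) zc zM.
  rewrite zY// -/(J e) => Jcvg.
  have H : `|series (J e) k - series (J e) n| @[k --> \oo] -->
    `|0 - series (J e) n|.
    by apply: cvg_norm; apply: cvgB; [exact: Jcvg|exact: cvg_cst].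
  have H' : M * e * (series b k - series b n) @[k --> \oo] -->
    M * e * (B - series b n).
    apply: cvgM; first exact: cvg_cst.
    by apply: cvgB; [exact: cb|exact: cvg_cst].
  have -> : `|series (J e) n| = `|0 - series (J e) n| by rewrite sub0r normrN.
  apply: (ler_cvg_to H H').
  near=> k; have nk : (n <= k)%N by near: k; exact: nbhs_infty_ge.
  rewrite !sub_series nk mulr_sumr; apply: le_trans (ler_norm_sum _ _ _) _.
  by apply: ler_sum => i _; exact: Jb.
(* Dividing by e = 1/(k + 1) turns the integrals into averages, which tend to the values at the
   nodes, while the bound loses its factor e. *)
have lim n : `|series (fun i =>
  al i * z (p i) + be i * z (q i)) n| <= M * (B - series b n).
  have avg c : k.+1%:R * I k.+1%:R^-1 c @[k --> \oo] --> z c.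
    by rewrite -[in z c](addr0 c); apply: cvg_average; exact: continuous_shift_arg.
  have H : `|\sum_(0 <= i < n) (al i * (k.+1%:R * I k.+1%:R^-1 (p i)) +
      be i * (k.+1%:R * I k.+1%:R^-1 (q i)))| @[k --> \oo] -->
      `|series (fun i => al i * z (p i) + be i * z (q i)) n|.
    apply: cvg_norm; rewrite /series/=; elim: n => [|n IHn].
      by under eq_fun do rewrite big_geq//; rewrite big_geq//; exact: cvg_cst.
    under eq_fun do rewrite big_nat_recr//=.
    rewrite big_nat_recr//=; apply: cvgD; first exact: IHn.
    by apply: cvgD; apply: cvgM; first [exact: cvg_cst|exact: avg].
  apply: (cvgr_to_le H); apply: nearW => k.
  rewrite (_ : \sum_(0 <= i < n) _ = k.+1%:R * series (J k.+1%:R^-1) n); last first.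
    by rewrite /series/= mulr_sumr; apply: eq_bigr => i _; rewrite /J; ring.
  rewrite normrM normr_nat -ler_pdivlMl// (le_trans (tail _ _ _)) ?invr_gt0//.
  by rewrite mulrCA mulrA.
apply/norm_cvg0P; apply: (@squeeze_cvgr _ _ _ _ (cst 0) (fun n =>
  M * (B - series b n))).
- by apply: nearW => n; rewrite normr_ge0 lim.
- exact: cvg_cst.
- rewrite -[X in _ --> X](mulr0 M) -(subrr B); apply: cvgM; first exact: cvg_cst.
  by apply: cvgB; [exact: cvg_cst|exact: cb].
Unshelve. all: by end_near. Qed.

(** By the addition formula each integral over [a, a + e] is cos(wa) C - sin(wa) S, with C and S
    independent of the node a. The hypothesis at the phases 0 and -pi/2 then makes the sum
    vanish. *)
Lemma trig_box_combination w c e : 0 < e ->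
  (forall c', series (fun i =>
    al i * cos (w * p i + c') + be i * cos (w * q i + c'))
     @ \oo --> (0 : R)) ->
  \int[mu]_x (cos (w * x + c) * box_series e x) = 0.
Proof.
move=> e0 H.
have cw : continuous (fun x => cos (w * x + c)).
  move=> x; apply: (@continuous_comp _ _ _ (fun x => w * x + c) cos);
    last exact: continuous_cos.
  by apply: cvgD; [apply: cvgM; [exact: cvg_cst|exact: cvg_id]|exact: cvg_cst].
have sw : continuous (fun x => sin (w * x + c)).
  move=> x; apply: (@continuous_comp _ _ _ (fun x => w * x + c) sin);
    last exact: continuous_sin.
  by apply: cvgD; [apply: cvgM; [exact: cvg_cst|exact: cvg_id]|exact: cvg_cst].
have c1 x : `|cos (w * x + c)| <= 1 by rewrite ler_norml cos_geN1 cos_le1.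
have [_ L] := box_series_integral (ltW e0) cw c1.
pose C := \int[mu]_(u in `[0, e]) cos (w * u + c).
pose S := \int[mu]_(u in `[0, e]) sin (w * u + c).
have IE a : \int[mu]_(u in `[0, e]) cos (w * (a + u) + c) = cos (w * a) * C
  - sin (w * a) * S.
  rewrite -!RintegralZl//; last 2 first.
    exact: continuous_itv_integrable.
    exact: continuous_itv_integrable.
  rewrite -RintegralB//; last 2 first.
    apply: continuous_itv_integrable => u.
    by apply: cvgM; [exact: cvg_cst|exact: cw].
    apply: continuous_itv_integrable => u.
    by apply: cvgM; [exact: cvg_cst|exact: sw].
  apply: eq_Rintegral => u _.
  by rewrite mulrDr -addrA cosD.
have L0 : series (fun i => al i * \int[mu]_(u in `[0, e]) cos (w * (p i + u) + c) +
    be i * \int[mu]_(u in `[0, e]) cos (w * (q i + u) + c)) @ \oo --> C * 0 - S * 0.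
  rewrite (_ : series _ = fun n => C *
    series (fun i => al i * cos (w * p i + 0) + be i * cos (w * q i + 0)) n - S *
    series (fun i => al i * cos (w * p i + - (pi / 2)) + be i * cos (w * q i +
      - (pi / 2))) n).
    by apply: cvgB; apply: cvgM; try exact: cvg_cst; exact: H.
  apply/funext => n; rewrite /series/= !mulr_sumr -sumrB; apply: eq_bigr => i _.
  by rewrite !addr0 !cosBpihalf !IE; ring.
by have := cvg_unique _ L L0; rewrite !mulr0 subrr; apply.
Qed.

End box_combination.
End box_functions.

(** * Unordered sums over the integers *)

Section centered_sums.
Variable R : realType.
Implicit Types (f : int -> R) (m k : int) (n : nat) (L s : seq int).

(* The terms at distance i from m, so that \sum_(0 <= i < n) symterm m f i is
   the sum of f k over |k - m| < n. *)
Definition symterm (V : zmodType) m (f : int -> V) (i : nat) : V :=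
  if i is i'.+1 then f (m + i'.+1%:Z) + f (m - i'.+1%:Z) else f m.

(** The center is listed apart, since m + 0 and m - 0 would repeat it. *)
Fixpoint centered m n : seq int :=
  if n is n'.+1 then
    if n' is 0 then [:: m] else [:: m + n'%:Z, m - n'%:Z & centered m n']
  else [::].

Lemma centeredS m n :
  centered m n.+2 = [:: m + n.+1%:Z, m - n.+1%:Z & centered m n.+1].
Proof. by []. Qed.

Lemma mem_centered m n k : (k \in centered m n) = (`|k - m| < n)%N.
Proof.
elim: n => [|[|n] IHn]; first by rewrite in_nil ltn0.
  by rewrite inE; lia.
rewrite centeredS 2!inE IHn; lia.
Qed.

Lemma uniq_centered m n : uniq (centered m n).
Proof.
elim: n => [|[|n] IHn]//.
rewrite centeredS !cons_uniq IHn andbT inE !mem_centered; lia.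
Qed.

Lemma sum_centered (V : zmodType) m (f : int -> V) n :
  \sum_(k <- centered m n) f k = \sum_(0 <= i < n) symterm m f i.
Proof.
elim: n => [|[|n] IHn]; first by rewrite big_geq// big_nil.
  by rewrite big_nat1 big_seq1.
by rewrite (@big_nat_recr _ _ _ n.+1)// -IHn centeredS !big_cons addrA addrC.
Qed.

(** At most two integers lie at each distance i from m, and the weight of i is 1/(i + 1) - 1/(i +
    2), so the sum telescopes. *)
Lemma sum_weight_centered_le m n N : (n <= N)%N ->
  \sum_(k <- centered m N | (n <= `|k - m|)%N) telescope_weight R `|k - m| <=
  2 * (n.+1%:R^-1 - N.+1%:R^-1).
Proof.
elim: N => [|N IHN]; first by rewrite leqn0 => /eqP ->; rewrite big_nil subrr mulr0.
rewrite leq_eqVlt => /predU1P[->|].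
  rewrite subrr mulr0 big_seq_cond big1// => k.
  by rewrite mem_centered => /andP[]; lia.
rewrite ltnS => nN.
have wE : telescope_weight R N = N.+1%:R^-1 - N.+2%:R^-1.
  have : 0 < N.+1%:R :> R by [].
  rewrite /telescope_weight -(natr1 N.+1); move: (N.+1%:R : R) => a a0; field.
  by rewrite !gt_eqF// addr_gt0.
have {IHN} := IHN nN.
have := telescope_weight_ge0 R N.
case: N => [|N] in nN wE *.
  move: nN; rewrite leqn0 => /eqP -> w0 _.
  by rewrite /= big_cons big_nil subrr/=; lra.
rewrite centeredS !big_cons.
have -> : absz (m + N.+1%:Z - m)%R = N.+1 by lia.
have -> : absz (m - N.+1%:Z - m)%R = N.+1 by lia.
rewrite nN wE => _; set S := \sum_(_ <- _ | _) _.
by move: (_^-1) (N.+2%:R^-1) (N.+3%:R^-1) => x y z IH; lra.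
Qed.

Lemma ler_sum_subset (F : int -> R) s L (P : pred int) : (forall k, 0 <= F k) ->
  uniq s -> uniq L -> {subset s <= L} ->
  \sum_(k <- s | P k) F k <= \sum_(k <- L | P k) F k.
Proof.
move=> F0 us uL sL.
have /(perm_big _)-> : perm_eq s [seq k <- L | k \in s].
  apply: uniq_perm => //; first exact: filter_uniq.
  by move=> k; rewrite mem_filter; case: (boolP (k \in s)) => //= /sL ->.
rewrite big_filter_cond [leRHS](bigID (mem s))/=.
rewrite (eq_bigl (fun k => P k && (k \in s))); last by move=> k; rewrite andbC.
by rewrite lerDl sumr_ge0.
Qed.

Lemma sum_weight_le m n s : uniq s ->
  \sum_(k <- s | (n <= `|k - m|)%N) telescope_weight R `|k - m| <= 2 / n.+1%:R.
Proof.
(* Larger than n and than every distance in [s], so that [s] is contained in [centered m N]. *)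
move=> us; set N := (n + \max_(k <- s) `|k - m|).+1.
apply: (@le_trans _ _ (\sum_(k <- centered m N | (n <= `|k - m|)%N)
  telescope_weight R `|k - m|)).
  apply: ler_sum_subset => //.
  - by move=> k; exact: telescope_weight_ge0.
  - exact: uniq_centered.
  - move=> k ks; rewrite mem_centered ltnS.
    apply: leq_trans (leq_addl _ _).
    exact: (@leq_bigmax_seq _ _ xpredT (fun k => `|k - m|%N)).
apply: le_trans (sum_weight_centered_le _ _) _; first by rewrite /N; lia.
by rewrite ler_wpM2l// lerBlDr lerDl invr_ge0.
Qed.

Lemma normc_cabs (z : R[i]) : `|z| = (cabs z)%:C%C.
Proof. by rewrite /cabs normc_def. Qed.

Lemma cabs_ge0 (z : R[i]) : 0 <= cabs z.
Proof. by rewrite -ler0c -normc_cabs. Qed.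

Lemma cabs_le_ReIm (z : R[i]) : cabs z <= `|complex.Re z| + `|complex.Im z|.
Proof.
rewrite /cabs normc_def/=; move: (complex.Re z) (complex.Im z) => a b.
rewrite -[leRHS]ger0_norm ?addr_ge0// -sqrtr_sqr ler_wsqrtr//.
rewrite sqrrD !real_normK ?num_real// -addrA lerD2l lerDr.
by rewrite mulrn_wge0// mulr_ge0.
Qed.

Lemma Re_le_cabs (z : R[i]) : `|complex.Re z| <= cabs z.
Proof. by rewrite -lecR -normc_cabs; exact: normc_ge_Re. Qed.

Lemma Im_le_cabs (z : R[i]) : `|complex.Im z| <= cabs z.
Proof.
rewrite /cabs normc_def/= -sqrtr_sqr ler_wsqrtr// lerDr; exact: sqr_ge0.
Qed.

Lemma cabs_sum_le (I : Type) (r : seq I) (P : pred I) (F : I -> R[i]) :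
  cabs (\sum_(i <- r | P i) F i) <= \sum_(i <- r | P i) cabs (F i).
Proof.
by rewrite -lecR -normc_cabs rmorph_sum/= (le_trans (ler_norm_sum _ _ _))//.
Qed.

Section has_sum_centered.
Variables (f : int -> R[i]) (l : R[i]) (m : int) (C : R).
Hypothesis fC : forall k, cabs (f k) <= C * telescope_weight R `|k - m|.
Hypothesis fl :
  cabs (l - \sum_(0 <= i < n) symterm m f i) @[n --> \oo] --> (0 : R).

Let C0 : 0 <= C.
Proof.
have := le_trans (cabs_ge0 _) (fC m).
by rewrite pmulr_lge0// invr_gt0 mulr_gt0.
Qed.

Let tail_le n s : uniq s ->
  \sum_(k <- s | (n <= `|k - m|)%N) cabs (f k) <= C * (2 / n.+1%:R).
Proof.
move=> us; apply: le_trans (ler_wpM2l C0 (sum_weight_le m n us)).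
by rewrite mulr_sumr; apply: ler_sum => k _; exact: fC.
Qed.

(** The tail estimate from distance 0 bounds all finite sums at once. *)
Lemma absolutely_convergent_centered : absolutely_convergent f.
Proof.
rewrite /absolutely_convergent /summable.
apply: (@le_lt_trans _ _ (C * 2)%:E); last exact: ltry.
apply: ub_ereal_sup => _ [A [finA _] <-].
rewrite fsbig_finite//=.
rewrite (eq_bigr (fun k => (cabs (f k))%:E)); last first.
  by move=> k _; rewrite /= ger0_norm// cabs_ge0.
rewrite sumEFin lee_fin.
by have := @tail_le 0 _ (fset_uniq (fset_set A)); rewrite divr1.
Qed.

(** The sum over a finite set containing [centered m n] differs from the symmetric partial sum by
    terms at distance at least n, and these are small whatever the set. *)
Lemma has_sum_centered : has_sum f l.
Proof.
have FF : ProperFilter (@summability.totally int).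
  exact: summability.totally_filter.
apply/cvgrPdist_le => e e0.
(* Positivity in [R[i]] includes being real. *)
have [r r0 eE] : exists2 r : R, 0 < r & e = r%:C%C.
  exists (complex.Re e).
    by move: e0; rewrite ltcE/= => /andP[].
  by move: e0; rewrite ltcE/= => /andP[/eqP ei _];
    rewrite [LHS]complexE ei mulr0 addr0.
have [n fn Cn] : exists2 n, cabs (l - \sum_(0 <= i < n) symterm m f i) <=
  r / 2 & C * (2 / n.+1%:R) <= r / 2.
  have r20 : 0 < r / 2 by rewrite divr_gt0.
  have H1 : \forall n \near \oo, cabs (l - \sum_(0 <= i < n) symterm m f i) <=
    r / 2.
    by have := fl => /cvgr_le; apply.
  have H2 : C * (2 / n.+1%:R) @[n --> \oo] --> C * (2 * (0 : R)).
    apply: cvgM; first exact: cvg_cst.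
    by apply: cvgM; [exact: cvg_cst|exact: cvg_harmonic].
  have {}H2 : \forall n \near \oo, C * (2 / n.+1%:R) <= r / 2.
    by move: H2; rewrite !mulr0 => /cvgr_le; apply.
  near \oo => n; exists n; near: n; [exact: H1|exact: H2].
exists [fset k in centered m n]%fset => // J /= nJ.
rewrite eE normc_cabs lecR /summability.partial_sum.
have -> : \sum_(i : J) f (val i) = \sum_(k <- J) f k by rewrite big_seq_fsetE.
rewrite (bigID (fun k => (n <= `|k - m|)%N))/=.
have -> : \sum_(k <- J | ~~ (n <= `|k - m|)%N) f k = \sum_(0 <= i < n)
  symterm m f i.
  rewrite -sum_centered -big_filter; apply: perm_big; apply: uniq_perm.
  - by rewrite filter_uniq ?fset_uniq.
  - exact: uniq_centered.
  - move=> k; rewrite mem_filter -ltnNge mem_centered andb_idr// => kn.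
    by apply: (fsubsetP nJ); rewrite in_fset mem_centered.
rewrite -lecR -normc_cabs opprD addrCA addrC (le_trans (ler_normB _ _))//.
rewrite !normc_cabs -rmorphD lecR [leRHS](splitr r) lerD//.
apply: le_trans (cabs_sum_le _ _ _) _; apply: le_trans Cn.
exact: tail_le (fset_uniq J).
Unshelve. all: by end_near. Qed.

End has_sum_centered.
End centered_sums.

(** * The expansion *)

Section exponential_expansion.
Variable R : realType.
Implicit Types (m k : int) (n : nat).
Local Notation mu := (@lebesgue_measure R).

(* The coefficient coef g m (m + j) t with G = g t and s = t - m, for non-integer
   t. *)
Definition kernel_coef (G s : R) (j : int) : R :=
  if j == 0 then 1 - G / pi
  else s * sin (G * j%:~R) / (pi * j%:~R * (j%:~R - s)).

Section kernel_coef.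
Variables (G s K : R).
Hypothesis s0 : 0 < s.
Hypothesis sK : forall j : int, `|j%:~R| <= K * `|j%:~R - s|.
Hypothesis sin_s : sin (pi * s) != 0.
Hypothesis Gpi : 0 < G < pi.
Hypothesis cos_Gs : cos (G * s) = 1.

Let sKn (j : nat) : j%:R <= K * `|j%:R - s|.
Proof. by have := sK j; rewrite ger0_norm. Qed.

Let sin_Gs : sin (G * s) = 0.
Proof.
by have := cos2Dsin2 (G * s); rewrite cos_Gs => H; apply/eqP;
  rewrite -sqrf_eq0; apply/eqP; lra.
Qed.

(** The terms at j and -j are paired. Product formulas turn sin(Gj) cos(wj) and sin(Gj) sin(wj) into
    sines and cosines of j(G + w) and j(G - w); over the common denominator j^2 - s^2 the
    coefficients are those of [sinS] and [cosS]. *)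
Lemma sum_kernel_coef w c n :
  \sum_(0 <= i < n.+1) symterm 0 (fun j =>
    kernel_coef G s j * cos (w * j%:~R + c)) i =
  cos c * (1 - G / pi + (sinS s n (G + w) + sinS s n (G - w)) / (2 * pi)) -
  sin c * ((cosS s n (G - w) - cosS s n (G + w)) / (2 * pi)).
Proof.
have pi0 : (pi : R) != 0 by rewrite gt_eqF// pi_gt0.
rewrite big_nat_recl//= big_mkord.
rewrite {1}/kernel_coef eqxx mulr0 add0r.
rewrite (eq_bigr (fun i : 'I_n => cos c / (2 * pi) *
  (2 * s ^+ 2 / (i.+1%:R * (i.+1%:R ^+ 2 - s ^+ 2)) * sin (i.+1%:R * (G + w)) +
   2 * s ^+ 2 / (i.+1%:R * (i.+1%:R ^+ 2 - s ^+ 2)) * sin (i.+1%:R * (G - w))) -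
  sin c / (2 * pi) *
  (2 * s / (i.+1%:R ^+ 2 - s ^+ 2) * cos (i.+1%:R * (G - w)) -
   2 * s / (i.+1%:R ^+ 2 - s ^+ 2) * cos (i.+1%:R * (G + w))))).
  rewrite sumrB -!mulr_sumr big_split/= sumrB -!/(sinS _ _ _) -!/(cosS _ _ _).
  by rewrite /sinS /cosS; move: (pi : R) pi0 => P P0; field.
move=> i _; rewrite !add0r /kernel_coef.
have -> : (i.+1%:Z == 0) = false by [].
have -> : (- i.+1%:Z == 0) = false by [].
rewrite rmorphN/= -[(i.+1%:Z)%:~R]/(i.+1%:R : R).
have j0 : i.+1%:R != 0 :> R by rewrite pnatr_eq0.
have d0 := @sqr_dist_neq0 R s K s0 sKn i.
move: (i.+1%:R : R) j0 d0 => j j0 d0.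
have d1 : j - s != 0 by apply: contraNneq d0; rewrite subr_sqr => ->; rewrite mul0r.
have d2 : - j - s != 0.
  by apply: contraNneq d0; rewrite subr_sqr -opprD => /eqP;
    rewrite oppr_eq0 => /eqP ->; rewrite mulr0.
rewrite !mulrN sinN (mulrDr j G w) (mulrBr j G w)
  sinD sinB cosD cosB (mulrC w j) (mulrC G j).
rewrite !cosD cosN sinN.
by move: (pi : R) pi0 => P P0; field; rewrite ?P0 ?j0 ?d0 ?d1 ?d2.
Qed.

(** For |w| < G < pi both G + w and G - w lie in (0, 2 pi), where the sums are known. *)
Lemma trig_expansion w c : - G < w < G ->
  series (symterm 0 (fun j => kernel_coef G s j * cos (w * j%:~R + c))) @ \oo -->
  cos (w * s + c).
Proof.
move=> wG; have [/andP[G0 Gpi'] /andP[Gw wG']] := conj Gpi wG.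
rewrite -cvg_shiftS/=.
under eq_fun do rewrite /series/= sum_kernel_coef.
have sL := cvg_sinS s0 sKn sin_s; have cL := cvg_cosS s0 sKn sin_s.
have xp : G + w \in `]0, 2 * pi[ by rewrite in_itv/=; apply/andP; split; lra.
have xm : G - w \in `]0, 2 * pi[ by rewrite in_itv/=; apply/andP; split; lra.
have pi0 : (pi : R) != 0 by rewrite gt_eqF// pi_gt0.
(* Since cos(Gs) = 1, the phase Gs drops out of the closed forms. The linear parts of [sinL] cancel
   1 - G/pi, and the terms 1/s cancel each other. *)
have -> : cos (w * s + c) =
  cos c * (1 - G / pi + (sinL s (G + w) + sinL s (G - w)) / (2 * pi)) -
  sin c * ((cosL s (G - w) - cosL s (G + w)) / (2 * pi)).
  rewrite /sinL /cosL.
  have -> : s * (G + w - pi) = (G * s - pi * s) + w * s by ring.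
  have -> : s * (G - w - pi) = (G * s - pi * s) - w * s by ring.
  rewrite !(sinD, sinB, cosD, cosB) !(cosN, sinN) cos_Gs sin_Gs.
  move: (sin (pi * s)) sin_s (cos (pi * s)) => S S0 C.
  by move: (pi : R) pi0 => P P0; field; rewrite ?P0 ?S0 ?gt_eqF.
apply: cvgB; (apply: cvgM; first exact: cvg_cst).
  apply: cvgD; first exact: cvg_cst.
  by apply: cvgM; [apply: cvgD; exact: sL|exact: cvg_cst].
by apply: cvgM; [apply: cvgB; exact: cL|exact: cvg_cst].
Qed.

(** The factor 1/j together with |j - s| >= |j|/K gives the decay 1/j^2. *)
Lemma normr_kernel_coef_le : exists D : R, forall j : int,
  `|kernel_coef G s j| <= D * telescope_weight R `|j|.
Proof.
have /andP[G0 Gp] := Gpi.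
have K0 : 0 <= K.
  by have := sK 0; rewrite normr0 sub0r normrN gtr0_norm// pmulr_lge0.
have pi0 : (pi : R) != 0 by rewrite gt_eqF// pi_gt0.
(* The 2 settles j = 0, where the weight is 1/2 and the coefficient at most 1; 6 is the largest
   value of (j + 1)(j + 2)/j^2 for j >= 1. *)
exists (2 + 6 * (s * K / pi)) => j; rewrite /kernel_coef.
have B0 : 0 <= s * K / pi by rewrite divr_ge0 ?pi_ge0// mulr_ge0 ?(ltW s0).
have [->|j0] := eqVneq j 0.
  rewrite /telescope_weight/= mul1r ger0_norm; last first.
    by rewrite subr_ge0 ler_pdivrMr ?pi_gt0//; lra.
  have : 0 <= G / pi by rewrite divr_ge0 ?pi_ge0//; lra.
  lra.
have jE : `|j|%:R = `|j%:~R| :> R by rewrite -intr_norm -abszE.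
have j1 : 1 <= `|j%:~R| :> R by rewrite -jE ler1n absz_gt0.
have w0 := telescope_weight_ge0 R `|j|.
have wj : 1 <= 6 * telescope_weight R `|j| * `|j%:~R| ^+ 2.
  rewrite /telescope_weight mulrAC ler_pdivlMr ?mulr_gt0// mul1r.
  rewrite -(natr1 `|j|.+1) -(natr1 `|j|) jE; nra.
have js0 : 0 < `|j%:~R - s|.
  rewrite lt_neqAle normr_ge0 andbT eq_sym; apply/eqP => E.
  by have := sK j; rewrite E mulr0; lra.
rewrite !normrM normfV !normrM (gtr0_norm s0) (gtr0_norm (pi_gt0 R)).
rewrite ler_pdivrMr; last by rewrite !mulr_gt0 ?pi_gt0//; lra.
have sin1 := sin_max (G * j%:~R).
apply: (@le_trans _ _ (s * 1)); first by rewrite ler_pM2l.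
apply: (@le_trans _ _ (6 * (s * K / pi)
  * telescope_weight R `|j| * (pi * `|j%:~R| * `|j%:~R - s|))).
  rewrite (_ : _ * (_ * _ * _) =
    s * (6 * telescope_weight R `|j| * `|j%:~R| * (K * `|j%:~R - s|))); last first.
    by move: (pi : R) pi0 => P P0; field.
  rewrite ler_pM2l//; apply: le_trans wj _.
  rewrite expr2 [leLHS]mulrA; apply: ler_wpM2l (sK j).
  by rewrite !mulr_ge0.
rewrite ler_wpM2r ?mulr_ge0 ?pi_ge0// ler_wpM2r//; lra.
Qed.
End kernel_coef.
End exponential_expansion.

(** * Linear relations between values of a band-limited signal *)

Section band_limited_signals.
Variable R : realType.
Implicit Types (m k : int) (n : nat).
Local Notation mu := (@lebesgue_measure R).

Lemma continuous_Re_Im (x : R -> R[i]) : continuous (x : R -> R[i]^o) ->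
  continuous (fun t => complex.Re (x t)) /\ continuous (fun t => complex.Im (x t)).
Proof.
move=> xc; split=> t; apply/cvgrPdist_le => e e0.
all: have /cvgrPdist_le /(_ e%:C) := xc t.
all: rewrite ltcR => /(_ e0); apply: filterS => u.
all: rewrite normc_cabs lecR; apply: le_trans.
- by have := Re_le_cabs (x t - x u); rewrite raddfB.
- by have := Im_le_cabs (x t - x u); rewrite raddfB.
Qed.

Lemma Lfun1_box_series (al be p q b : nat -> R) e :
  (forall i, `|al i| + `|be i| <= b i) -> cvgn (series b) -> 0 <= e ->
  in_Lp 1%E (fun t => (box_series al be p q e t)%:C).
Proof.
move=> alb cb e0; split; apply/Lfun1_integrable.
  exact: (integrable_box_series p q alb cb e0).
rewrite (_ : _ \o _ = cst 0%E); last by apply/funext => t.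
exact: integrable0.
Qed.

(** A relation valid for the exponentials of the band passes to the signal: the box series are
    integrable and their transforms vanish on the band, so they are test functions for the spectral
    gap. Shrinking the boxes leaves the values at the nodes. *)
Lemma band_limited_relation Omega (x : R -> R[i]) (al be p q b : nat -> R) :
  continuous_bounded x -> band_limited Omega x ->
  (forall i, `|al i| + `|be i| <= b i) -> cvgn (series b) ->
  (forall w c, - Omega < w < Omega ->
    series (fun i => al i * cos (w * p i + c) + be i * cos (w * q i + c))
      @ \oo --> (0 : R)) ->
  series (fun i => al i * complex.Re (x (p i)) + be i * complex.Re (x (q i)))
    @ \oo --> (0 : R) /\
  series (fun i => al i * complex.Im (x (p i)) + be i * complex.Im (x (q i)))
    @ \oo --> (0 : R).
Proof.
move=> [/continuous_Re_Im[Rc Ic] [M xM]] [_ [_ _ gap]] alb cb trig.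
have ReZ (z : R[i]) (c : R) : complex.Re (z * c%:C) = complex.Re z * c.
  by case: z => u v /=; rewrite mulr0 subr0.
have ImZ (z : R[i]) (c : R) : complex.Im (z * c%:C) = complex.Im z * c.
  by case: z => u v /=; rewrite mulr0 add0r.
have x0 e : 0 < e -> cintegral (fun t => x t * (box_series al be p q e t)%:C) = 0.
  move=> e0; apply: gap; first exact: (Lfun1_box_series p q alb cb (ltW e0)).
  (* Being outside the gap means lying in (-Omega, Omega). *)
  move=> w /contrapT w_lt; have trig0 c :
    \int[mu]_t (cos (w * t + c) * box_series al be p q e t) = 0.
    by apply: (@trig_box_combination R al be p q b alb cb w c e e0) => c';
      exact: trig.
  rewrite /fourier /cintegral; apply/eqP; rewrite eq_complex/=; apply/andP;
    split; apply/eqP.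
    apply: etrans (trig0 0); apply: eq_Rintegral => t _.
    by rewrite addr0 cosN mulr0 subr0.
  (* The phase pi/2 turns the cosine into -sin(wt), the imaginary part of the Fourier kernel. *)
  apply: etrans (trig0 (pi / 2)); apply: eq_Rintegral => t _.
  by rewrite cosDpihalf sinN mulr0 add0r.
split.
  apply: (@vanishing_box_combination R al be p q b alb cb
    (fun t => complex.Re (x t)) M Rc).
  - by move=> t; exact: le_trans (Re_le_cabs _) (xM t).
  - move=> e /x0 /(congr1 (@complex.Re R)) /=.
    by under eq_Rintegral do rewrite ReZ.
apply: (@vanishing_box_combination R al be p q b alb cb
  (fun t => complex.Im (x t)) M Ic).
- by move=> t; exact: le_trans (Im_le_cabs _) (xM t).
- move=> e /x0 /(congr1 (@complex.Im R)) /=.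
  by under eq_Rintegral do rewrite ImZ.
Qed.
End band_limited_signals.

(** * The expansion of a signal at a non-integer point *)

Section expansion.
Variable R : realType.
Implicit Types (m k : int) (n : nat).

Lemma symterm_shift (V : zmodType) m (f : int -> V) i :
  symterm m f i = symterm 0 (fun j => f (m + j)) i.
Proof. by case: i => [|i] /=; rewrite ?addr0// !add0r. Qed.

Lemma cabsM_real (a : R) (z : R[i]) : cabs (a%:C * z) = `|a| * cabs z.
Proof.
apply: (@complexI R); rewrite rmorphM/= -!normc_cabs normrM; congr (_ * _).
by rewrite normc_def/= expr0n addr0 sqrtr_sqr.
Qed.

Section kernel_expansion.
Variables (G s K : R).
Hypothesis s0 : 0 < s.
Hypothesis sK : forall j : int, `|j%:~R| <= K * `|j%:~R - s|.
Hypothesis sin_s : sin (pi * s) != 0.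
Hypothesis Gpi : 0 < G < pi.
Hypothesis cos_Gs : cos (G * s) = 1.

(** The expansion of the cosines of the band relates values at t to values at the integers, so it
    holds for the signal. It comes as a symmetric sum, which the decay of the a_k makes
    unordered. *)
Lemma kernel_expansion Omega (x : R -> R[i]) m (a : int -> R) :
  Omega <= G -> continuous_bounded x -> band_limited Omega x ->
  (forall j, a (m + j) = kernel_coef G s j) ->
  absolutely_convergent (fun k : int => (a k)%:C * x k%:~R) /\
  has_sum (fun k : int => (a k)%:C * x k%:~R) (x (s + m%:~R)).
Proof.
move=> OG xcb xbl aE; set t := s + m%:~R.
have [D aD] := normr_kernel_coef_le s0 sK Gpi.
have D0 : 0 <= D.
  have := le_trans (normr_ge0 _) (aD 0).
  by rewrite pmulr_lge0// invr_gt0 mulr_gt0.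
have aw k : `|a k| <= D * telescope_weight R `|k - m|.
  by have := aD (k - m); rewrite -aE (addrC m) subrK.
pose al (i : nat) := a (m + i%:Z).
(* The slot i = 0 holds the coefficient -1 at the node t, so that the expansion becomes a relation
   with sum 0. *)
pose be (i : nat) := if i is i'.+1 then a (m - i'.+1%:Z) else -1.
pose p (i : nat) : R := (m + i%:Z)%:~R.
pose q (i : nat) : R := if i is i'.+1 then (m - i'.+1%:Z)%:~R else t.
(* [2 * D] covers the two coefficients at distance i, the other 2 covers |-1| at i = 0, where the
   weight is 1/2. *)
pose b (i : nat) := (2 * D + 2) * telescope_weight R i.
have alb i : `|al i| + `|be i| <= b i.
  have := aw (m + i%:Z); rewrite -/(al i) (_ : absz (m + i%:Z - m)%R = i);
    last by lia.
  rewrite /b; have := telescope_weight_ge0 R i; case: i => [|i] w0 ali.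
    by rewrite /be normrN1; move: ali; rewrite /telescope_weight; lra.
  have := aw (m - i.+1%:Z);
    rewrite -/(be i.+1) (_ : absz (m - i.+1%:Z - m)%R = i.+1); last by lia.
  move: (telescope_weight R i.+1) w0 ali => w w0; lra.
have cb : cvgn (series b).
  have : cvgn (series ((2 * D + 2) *: (telescope_weight R : R^o ^nat))).
    apply: is_cvg_seriesZ; apply/cvg_ex; exists 1; exact: cvg_telescope_weight.
  exact.
(* From the first term on, a partial sum contains the contribution [- z t] of the slot i = 0. *)
have serE (z : R -> R) n : series (fun i => al i * z (p i) + be i * z (q i)) n.+1 =
    series (symterm m (fun k => a k * z k%:~R)) n.+1 - z t.
  rewrite /series/= !big_nat_recl//= [RHS]addrAC; congr (_ + _).
  by rewrite /al /p addr0 mulN1r.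
have trig w c : - Omega < w < Omega ->
    series (fun i => al i * cos (w * p i + c) + be i * cos (w * q i + c))
      @ \oo --> (0 : R).
  move=> /andP[wl wu].
  have wG : - G < w < G by apply/andP; split; lra.
  have H : series (symterm m (fun k =>
    a k * cos (w * k%:~R + c))) n.+1 - cos (w * t + c)
      @[n --> \oo] --> cos (w * t + c) - cos (w * t + c).
    apply: cvgB; last exact: cvg_cst.
    have -> : symterm m (fun k => a k * cos (w * k%:~R + c)) =
        symterm 0 (fun j => kernel_coef G s j * cos (w * j%:~R + (w * m%:~R + c))).
      apply/funext => i; rewrite symterm_shift; congr symterm; apply/funext => j.
      by rewrite aE; congr (_ * cos _); rewrite intrD; ring.
    have := @trig_expansion R G s K s0 sK sin_s Gpi cos_Gs w (w * m%:~R + c) wG.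
    rewrite -cvg_shiftS /t mulrDr -addrA; exact.
  rewrite subrr in H; rewrite -cvg_shiftS.
  by under eq_fun do rewrite (serE (fun u => cos (w * u + c))).
have [HR HI] := band_limited_relation xcb xbl alb cb trig.
have [M xM] := xcb.2.
have fC k : cabs ((a k)%:C * x k%:~R) <= D * M * telescope_weight R `|k - m|.
  rewrite cabsM_real mulrAC; apply: ler_pM => //; exact: cabs_ge0.
suff fl : cabs (x t - \sum_(0 <= i < n) symterm m (fun k => (a k)%:C * x k%:~R) i)
    @[n --> \oo] --> (0 : R).
  split; first exact: absolutely_convergent_centered fC.
  exact: has_sum_centered fC fl.
have symRI (h : {additive R[i] ->
  R}) : (forall (u : R) z, h (u%:C * z) = u * h z) ->
    forall n, h (x t - \sum_(0 <= i < n) symterm m (fun k =>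
      (a k)%:C * x k%:~R) i) =
      h (x t) - series (symterm m (fun k => a k * h (x k%:~R))) n.
  move=> hZ n; rewrite raddfB raddf_sum/=; congr (_ - _); apply: eq_bigr => i _.
  by case: i => [|i] /=; rewrite ?raddfD/= !hZ.
have neg (z : R -> R) : series (fun i => al i * z (p i) + be i * z (q i))
  @ \oo --> (0 : R) ->
    z t - series (symterm m (fun k => a k * z k%:~R)) n.+1 @[n --> \oo] -->
      - (0 : R).
  move=> H; rewrite (_ : (fun n => _) =
    fun n => - series (fun i => al i * z (p i) + be i * z (q i)) n.+1); last first.
    by apply/funext => n; rewrite serE opprB.
  by apply: cvgN; move: H; rewrite -cvg_shiftS.
have fl0 : `|complex.Re (x t) - series (symterm m (fun k =>
  a k * complex.Re (x k%:~R))) n.+1| +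
    `|complex.Im (x t) - series (symterm m (fun k =>
      a k * complex.Im (x k%:~R))) n.+1|
    @[n --> \oo] --> `|- (0 : R)| + `|- (0 : R)|.
  apply: cvgD; apply: cvg_norm.
    exact: (neg (fun u => complex.Re (x u)) HR).
  exact: (neg (fun u => complex.Im (x u)) HI).
rewrite oppr0 normr0 addr0 in fl0; rewrite -cvg_shiftS.
apply: (squeeze_cvgr _ (cvg_cst 0) fl0); apply: nearW => n.
rewrite cabs_ge0/= (le_trans (cabs_le_ReIm _))//.
rewrite (symRI (@complex.Re R)); last by move=> u [v w] /=; rewrite mul0r subr0.
by rewrite (symRI (@complex.Im R)) // => u [v w] /=; rewrite mul0r addr0.
Qed.
End kernel_expansion.
End expansion.

(** * Sums with a single term, and integer shifts *)

Section trigonometry_and_periods.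
Variable R : realType.
Implicit Types (m k : int) (n : nat).

(** Serves for integer t, where one coefficient is nonzero. The factor 2 in the bound offsets the
    weight 1/2 at distance 0. *)
Lemma has_sum_single (f : int -> R[i]) k0 : (forall k, k != k0 -> f k = 0) ->
  absolutely_convergent f /\ has_sum f (f k0).
Proof.
move=> f0; have fC k : cabs (f k) <= 2 * cabs (f k0) * telescope_weight R `|k - k0|.
  have [->|/f0 ->] := eqVneq k k0.
    by rewrite subrr /telescope_weight/= mul1r mulrAC divff// mul1r.
  by rewrite /cabs normr0/= !mulr_ge0 ?telescope_weight_ge0// cabs_ge0.
split; first exact: absolutely_convergent_centered fC.
apply: (has_sum_centered fC); rewrite -cvg_shiftS.
rewrite (_ : (fun n => _) = cst 0); first exact: cvg_cst.
apply/funext => n /=; rewrite big_nat_recl//= big1 ?addr0 ?subrr.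
  by rewrite /cabs normr0.
by move=> i _; rewrite !f0 ?addr0//; lia.
Qed.

Lemma periodic_int (f : R -> R) : periodic f 1 -> forall m u, f (u + m%:~R) = f u.
Proof.
move=> fp [n|n] u; first exact: periodicn fp n u.
rewrite -[LHS](periodicn fp n.+1); congr f; exact: subrK.
Qed.

Lemma sin_intpi k : sin (pi * k%:~R) = 0 :> R.
Proof.
case: k => n; first by rewrite mulrC; exact: sin_natpi.
by rewrite NegzE mulrNz mulrN sinN mulrC -[_%:~R]/(n.+1%:R) sin_natpi oppr0.
Qed.

Lemma cos_natpi2 n : cos (pi * (n * 2)%:R) = 1 :> R.
Proof.
elim: n => [|n IHn]; first by rewrite mulr0 cos0.
by rewrite mulSn addnC natrD mulrDr (mulr_natr _ 2) cosD2pi.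
Qed.
End trigonometry_and_periods.

Unset Implicit Arguments.

Theorem theorem2p2 (R : realType) (Omega : R) (N : int) (Omega1 : R)
    (g : R -> R)
    (hOmega : 0 < Omega < pi)
    (hNeven : (2 %| N)%Z)
    (hN : N%:~R > Omega / (pi - Omega))
    (hOmega1 : Omega < Omega1 < pi)
    (hN1 : N%:~R >= Omega1 / (pi - Omega1))
    (hg_range : forall t : R, Omega1 <= g t <= pi)
    (hg_periodic : periodic g 1)
    (hg : forall t : R, N%:~R <= t < (N + 1)%:~R -> g t = pi * N%:~R / t)
    (x : R -> R[i])
    (hx_cont : continuous_bounded x)
    (hx_band : band_limited Omega x)
    (m : int) (t : R)
    (ht : (N + m)%:~R <= t < (N + m + 1)%:~R) :
  absolutely_convergent (fun k : int => (coef g m k t)%:C * x k%:~R) /\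
  has_sum (fun k : int => (coef g m k t)%:C * x k%:~R) (x t).
Proof.
have /andP[om0 ompi] := hOmega; have /andP[omO1 O1pi] := hOmega1.
have N0 : 0 < N%:~R :> R.
  by apply: le_lt_trans hN; rewrite divr_ge0//; lra.
have [n nN] : exists n : nat, N = (n * 2)%N.
  move: hNeven N0 => /dvdzP[[n|n] ->]; first by exists n.
  by rewrite ltr0z NegzE; lia.
(* Evenness of N: the product g(s) s = pi N is a multiple of 2 pi. *)
have cosN2 : cos (pi * N%:~R) = 1 :> R.
  by rewrite nN -[_%:~R]/((n * 2)%:R) cos_natpi2.
have sinN2 : sin (pi * N%:~R) = 0 :> R.
  exact: sin_intpi.
pose s := t - m%:~R.
have [Ns sN1] : N%:~R <= s /\ s < N%:~R + 1.
  by move: ht; rewrite !intrD /s => /andP[]; lra.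
have s0 : 0 < s by lra.
have gts : g t = g s by rewrite -[t](subrK m%:~R) periodic_int.
have gs : g s = pi * N%:~R / s.
  by apply: hg; rewrite intrD Ns sN1.
(* If s = N, then g(t) = pi and t = N + m: every coefficient vanishes, a_m included, except the one
   at k = t, which is 1 by the convention for 0/0. *)
have [sE|sN'] := eqVneq s N%:~R.
  have tE : t = (N + m)%:~R by rewrite intrD -sE /s subrK.
  have coef0 k : k != N + m -> coef g m k t = 0.
    move=> kNm; rewrite /coef; case: eqP => [_|/eqP km].
      by rewrite gts gs sE mulfK ?divff ?subrr// gt_eqF// pi_gt0.
    rewrite tE eqr_int eq_sym (negbTE kNm) -tE gts gs sE mulfK ?gt_eqF//.
    by rewrite sin_intpi mulr0 mul0r.
  (* Since N > 0, the index N + m differs from m. *)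
  have coef1 : coef g m (N + m) t = 1.
    rewrite /coef ifN; first by rewrite tE eqxx.
    by move: N0; rewrite ltr0z; lia.
  have -> : x t = (coef g m (N + m) t)%:C * x (N + m)%:~R.
    by rewrite coef1 tE mul1r.
  apply: (@has_sum_single R (fun k => (coef g m k t)%:C * x k%:~R)) => k /coef0 ->.
  by rewrite mul0r.
have Ns' : N%:~R < s by rewrite lt_neqAle eq_sym sN'.
(* The distance from s to the nearest integer. *)
pose d := Num.min (s - N%:~R) (N%:~R + 1 - s).
have d0 : 0 < d by rewrite lt_min; apply/andP; split; lra.
have sd (j : int) : d <= `|j%:~R - s|.
  rewrite /d ge_min; have [jN|Nj] := leP j N.
    have : j%:~R <= N%:~R :> R by rewrite ler_int.
    by move=> jN'; apply/orP; left; rewrite ler0_norm; lra.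
  have : N%:~R + 1 <= j%:~R :> R.
    have -> : N%:~R + 1 = (N + 1)%:~R :> R by rewrite intrD.
    by rewrite ler_int lezD1.
  by move=> jN'; apply/orP; right; rewrite ger0_norm; lra.
(* From |j| <= |j - s| + s and s <= (s/d) |j - s|. *)
have sK (j : int) : `|j%:~R| <= (1 + s / d) * `|j%:~R - s|.
  rewrite mulrDl mul1r.
  have : s <= s / d * `|j%:~R - s| by rewrite mulrAC ler_pdivlMr// ler_pM2l.
  have := ler_normD (j%:~R - s) s; rewrite subrK (gtr0_norm s0); lra.
(* The upper bound is strict because g(s) = pi N/s with s > N. *)
have Gpi : 0 < g s < pi.
  have /andP[gO1 _] := hg_range s; apply/andP; split; first lra.
  by rewrite gs ltr_pdivrMr// ltr_pM2l ?pi_gt0.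
have cos_gs : cos (g s * s) = 1 by rewrite gs mulfVK ?gt_eqF.
(* N is even, so sin(pi s) = sin(pi (s - N)) with 0 < s - N < 1. *)
have sin_s : sin (pi * s) != 0.
  rewrite (_ : pi * s = pi * (s - N%:~R) + pi * N%:~R); last by ring.
  rewrite sinD cosN2 sinN2 mulr1 mulr0 addr0 gt_eqF// sin_gt0_pi//.
  apply/andP; split; first by rewrite mulr_gt0 ?pi_gt0// subr_gt0.
  by rewrite gtr_pMr ?pi_gt0//; lra.
rewrite (_ : t = s + m%:~R); last by rewrite subrK.
apply: (@kernel_expansion R (g s) s (1 + s / d)
  s0 sK sin_s Gpi cos_gs Omega x m) => //.
  by have /andP[gO1 _] := hg_range s; lra.
move=> j; have jm : m + j - m = j by rewrite (addrC m) addrK.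
have gE : g (s + m%:~R) = g s by rewrite periodic_int.
rewrite /coef /kernel_coef -subr_eq0 jm gE addrK; case: ifP => // _.
(* Here t is not an integer, so the branch t = k of [coef] is never taken. *)
rewrite (addrC m) intrD ifF; last first.
  apply/negbTE; rewrite (can_eq (addrK _)) eq_sym -subr_eq0 -normr_gt0.
  exact: lt_le_trans (sd j).
by rewrite opprD addrACA subrr addr0.
Qed.
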